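(* Let $m\ge 1$ be an integer, let $x,y\in \mathrm{C}^\alpha$ with $\alpha\in(0,1)$ and $\alpha>1/(2m+1)$, and let $A$ be an $\alpha$-Lévy area of order $2m-2$ associated with $\gamma=(x,y)$. For $f:\mathbb{R}\to\mathbb{R}$ a $\mathscr{C}^{2m}$ function, define $$I_\varepsilon^{\gamma}(f)=\varepsilon^{-1}\int_0^1 (x_{u+\varepsilon}-x_u)\left(\int_0^1 f\big((1-\theta)y_u+\theta y_{u+\varepsilon}\big)\,\nu_m(\mathrm{d}\theta)\right)\mathrm{d}u+\varepsilon^{-1}\sum_{k=0}^{2m-2}\frac{1}{(k+1)!}\int_0^1 f^{(k+1)}(y_u)\,A_{u,u+\varepsilon}\big[(Y-y_u)^k\big]\,\mathrm{d}u$$ for every $\varepsilon>0$. Then the family $\{I_\varepsilon^\gamma(f),\varepsilon>0\}$ converges when $\varepsilon\downarrow 0$. Its limit is denoted by $$I^\gamma(f)=\int_0^1 f(y_u)\,\mathrm{d}^{A,m}x_u$$ and is called the $m$-order Newton–Côtes functional corrected by $A$ of $f(y)$ with respect to $x$. In addition, these functionals are compatible in the following sense: if $\alpha>1/(2m+1)$, then for all integers $n>m$ and any $\alpha$-Lévy area $A$ of order $2n-2$ associated with $\gamma$, $$\int_0^1 f(y_u)\,\mathrm{d}^{A,n}x_u=\int_0^1 f(y_u)\,\mathrm{d}^{A,n-1}x_u=\cdots=\int_0^1 f(y_u)\,\mathrm{d}^{A,m}x_u .$$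
   Context: $\mathrm{C}^\alpha$ is the set of functions $z:[0,1]\to\mathbb{R}$ for which there is $L>0$ with $|z_t-z_s|\le L|t-s|^\alpha$ for all $s,t\in[0,1]$. Measures $\nu_m$: $\nu_1=\frac12(\delta_0+\delta_1)$, and for $m\ge2$, $$\nu_m=\sum_{j=0}^{2m-2}\left(\int_0^1\prod_{0\le k\le 2m-2,\,k\ne j}\frac{2(m-1)u-k}{j-k}\,\mathrm{d}u\right)\delta_{j/(2m-2)},$$ where $\delta_a$ is the Dirac mass at $a$. Lévy area: let $\mathcal{P}_{2m-2}$ be the space of real polynomials in one variable $Y$ of degree at most $2m-2$. For $x,y\in\mathrm{C}^\alpha$ and $\gamma_t=(x_t,y_t)$, an $\alpha$-Lévy area of order $2m-2$ associated with $\gamma$ is a family $A=(A_{st})_{s,t\in[0,1]}$ of linear maps $A_{st}:\mathcal{P}_{2m-2}\to\mathbb{R}$ such that: (i) for all $r,s,t\in[0,1]$ and $k\in\{0,\dots,2m-2\}$, $A_{rs}(Y^k)+A_{st}(Y^k)+A_{tr}(Y^k)=-\iint_{T_{rst}}\eta^k\,\mathrm{d}\xi\,\mathrm{d}\eta$, where $T_{rst}$ is the oriented triangle with vertices $\gamma_r,\gamma_s,\gamma_t$ (coordinates $(\xi,\eta)$), and the integral is signed by the orientation so that for $k=0$ it equals $\mathrm{area}(T_{rst})=\frac12[(y_t-y_s)(x_r-x_s)-(y_r-y_s)(x_t-x_s)]$; (ii) there is $C>0$ such that for all $s,t\in[0,1]$, all $k\in\{0,\dots,2m-2\}$ and all $\zeta\in[y_s,y_t]$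 (the segment between $y_s$ and $y_t$), $|A_{st}[(Y-\zeta)^k]|\le C|t-s|^{2m\alpha}$. For $m\le j\le n$, $\int_0^1 f(y_u)\,\mathrm{d}^{A,j}x_u$ denotes the limit as $\varepsilon\downarrow0$ of the expression defining $I^\gamma_\varepsilon(f)$ with $m$ replaced by $j$; a Lévy area $A$ of order $2n-2$ is regarded as one of order $2j-2$ by restriction to polynomials of degree at most $2j-2$. The paper does not specify how $x$, $y$ and $A$ are to be read at times larger than $1$. *)

(* Defs.v *)
From HB Require Import structures.
From mathcomp Require Import all_boot all_order all_algebra.
From mathcomp Require Import all_classical all_reals all_analysis.
Import Order.TTheory GRing.Theory Num.Theory.
Import numFieldNormedType.Exports.

Set Implicit Arguments.
Unset Strict Implicit.
Unset Printing Implicit Defensive.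

Local Open Scope classical_set_scope.
Local Open Scope ring_scope.

Section Defs.
Variable R : realType.
Implicit Types (x y f : R -> R) (m : nat) (alpha : R).

Local Notation mu := (@lebesgue_measure R).

(* Functions on [0, 1] are represented by total functions on R, whose values
   outside [0, 1] are never used. *)
Definition hoelder_path alpha (z : R -> R) : Prop :=
  exists2 L : R, 0 < L & forall s t : R, s \in `[0, 1] -> t \in `[0, 1] ->
    `|z t - z s| <= L * `|t - s| `^ alpha.

Definition Cclass (k : nat) f : Prop :=
  (forall i, (i < k)%N -> forall t : R, derivable (derive1n i f) t 1) /\
  continuous (derive1n k f).

(* A finite signed combination of Dirac masses is a list of pairs
   (weight, atom). *)
Definition nc_weight m (j : nat) : R :=
  (\int[mu]_(u in `[0%R, 1%R])
     (\prod_(0 <= k < m.*2.-1 | k != j)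
        ((2 * (m%:R - 1) * u - k%:R) / (j%:R - k%:R))))%R.

Definition nu m : seq (R * R) :=
  if m == 1%N then [:: (2^-1, 0); (2^-1, 1)]
  else [seq (nc_weight m j, j%:R / (m.*2 - 2)%:R) | j <- iota 0 m.*2.-1].

Definition dirac_integral (d : seq (R * R)) (g : R -> R) : R :=
  \sum_(a <- d) a.1 * g a.2.

(* The (closed, filled) triangle with vertices p, q, r. *)
Definition triangle (p q r : R * R) : set (R * R) :=
  [set v | exists a b c : R, [/\ 0 <= a, 0 <= b, 0 <= c, a + b + c = 1 &
     v = (a * p.1 + b * q.1 + c * r.1, a * p.2 + b * q.2 + c * r.2)]].

(* Twice this number is the determinant of (p - q, r - q): it is positive when
   p, q, r are listed clockwise. *)
Definition signed_area (p q r : R * R) : R :=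
  2^-1 * ((r.2 - q.2) * (p.1 - q.1) - (p.2 - q.2) * (r.1 - q.1)).

Definition signed_moment (p q r : R * R) (k : nat) : R :=
  Num.sg (signed_area p q r) *
  (\int[(mu \x mu)%E]_(v in triangle p q r) (v.2 ^+ k))%R.

(* An alpha-Levy area of order 2m-2. Each A s t is a total function on
   {poly R}, of which only the restriction to the polynomials of degree at
   most 2m-2 (i.e. of size at most 2m-1) is constrained: an area of order 2n-2
   is thus viewed as one of order 2j-2, j <= n, without any coercion. *)
Definition levy_area alpha m x y (A : R -> R -> {poly R} -> R) : Prop :=
  [/\ forall s t : R, s \in `[0, 1] -> t \in `[0, 1] ->
        forall (c : R) (p q : {poly R}),
          (size p <= m.*2.-1)%N -> (size q <= m.*2.-1)%N ->
          A s t (c *: p + q) = c * A s t p + A s t q,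
      forall r s t : R, r \in `[0, 1] -> s \in `[0, 1] -> t \in `[0, 1] ->
        forall k, (k <= m.*2 - 2)%N ->
          A r s 'X^k + A s t 'X^k + A t r 'X^k =
          - signed_moment (x r, y r) (x s, y s) (x t, y t) k
    & exists2 C : R, 0 < C &
        forall s t : R, s \in `[0, 1] -> t \in `[0, 1] ->
        forall k, (k <= m.*2 - 2)%N -> forall zeta : R,
          Num.min (y s) (y t) <= zeta <= Num.max (y s) (y t) ->
          `|A s t (('X - zeta%:P) ^+ k)| <= C * `|t - s| `^ (m.*2%:R * alpha)].

(* Convention beyond time 1: x, y and A are frozen there, i.e. the time u + eps
   is read as min (u + eps) 1. *)
Definition nc_approx m x y (A : R -> R -> {poly R} -> R) f (eps : R) : R :=
  let stop (t : R) := Num.min t 1 in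
  eps^-1 *
    (\int[mu]_(u in `[0%R, 1%R])
       ((x (stop (u + eps)) - x u) *
        dirac_integral (nu m)
          (fun theta => f ((1 - theta) * y u + theta * y (stop (u + eps))))))%R
  + eps^-1 *
    \sum_(0 <= k < m.*2.-1)
      ((k.+1)`!%:R)^-1 *
      (\int[mu]_(u in `[0%R, 1%R])
         (derive1n k.+1 f (y u) *
          A u (stop (u + eps)) (('X - (y u)%:P) ^+ k)))%R.

(* The m-order Newton-Cotes functional of f(y) with respect to x, corrected
   by A; meaningful when the limit exists. *)
Definition nc_integral m x y (A : R -> R -> {poly R} -> R) f : R :=
  lim (nc_approx m x y A f eps @[eps --> 0^'+]).

End Defs.

(* Main.v *)
Require Import Defs.
From HB Require Import structures.
From mathcomp Require Import all_boot all_order all_algebra.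
From mathcomp Require Import all_classical all_reals all_analysis.
From mathcomp Require Import measurable_realfun ring lra zify.
Import Order.TTheory GRing.Theory Num.Theory.
Import numFieldNormedType.Exports.

Local Open Scope classical_set_scope.
Local Open Scope ring_scope.

(** The functional is the limit of the averages [e^-1 \int_0^1 J(u, u + e) du]
of the germ [J(s, t)] made of the Newton-Cotes and the Levy area terms over the
segment from [s] to [t]. These averages converge as soon as [J] is additive up
to [O(|t - s|^b)] with [b > 1]: then [g(e) = \int_0^1 J(u, u + e) du] is itself
additive up to [O(e^b')], [b' > 1], so that [g(n e)] is close to [n g(e)] and
[g(e) / e] is Cauchy.

Near-additivity holds with [b = (2m+1) alpha]. Condition (i) for [k = 0] together
with (ii) shows that all triangles inscribed in the path have area
[O(|t - s|^(2m alpha))]. Since [nu_m] is exact up to degree [2m - 1], a Taylor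
expansion of [f] at [y_s] shows that the defect of additivity of the Newton-Cotes
term is [f'(y_s)] times the signed area of the triangle, up to
[O(|t - s|^((2m+1) alpha))]; it is cancelled by the term [k = 0] of the Levy part,
and the terms [k >= 1] only contribute to the remainder. In the second part
the germs of orders [j] and [j + 1] differ by [O(|t - s|^((2j+1) alpha))], because
[2 n alpha >= (2j+1) alpha], hence the averages have the same limit. *)

(** * Integrals of continuous functions *)

Section RealIntegral.
Context {R : realType}.
Implicit Types f F : R -> R.
Local Notation mu := (@lebesgue_measure R).

(** The time u + e may leave [0, 1], so [x], [y] and [A] are precomposed with the projection onto
    [0, 1]: the estimates then hold at all real times, and the germ vanishes beyond time 1. This
    vanishing settles the main obstacle in averaging. Adding the germs over two consecutive steps of
    lengths h and k and integrating in u produces the second germ over a shifted window; moving the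
    window back to [0, 1] costs h times the size k^alpha of a germ. Hence b' = min((2m+1) alpha, 1 +
    alpha). In (2m+1) alpha, the part 2m alpha is the size of a triangle or of a Taylor remainder of
    order 2m, and the last alpha comes from one more increment of the path. For k >= 1, the moment
    of (Y - y_s)^k over a triangle with vertex gamma_s already has this order, which is why only k =
    0 needs a cancellation. The integrals can be split and merged because the germ is continuous in
    u. For the Levy terms this needs (i) as well as (ii), since (ii) gives smallness only at close
    times. *)

Lemma continuous_integrable_segment (a b : R) f :
  continuous f -> mu.-integrable `[a, b] (EFin \o f).
Proof.
move=> cf; apply: continuous_compact_integrable; first exact: segment_compact.
exact: continuous_subspaceT.
Qed.

Lemma primitive_exists (c : R) f : continuous f ->
  exists F, forall x, c < x -> is_derive x 1 F (f x).
Proof.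
move=> cf; exists (fun x => \int[mu]_(t in `[c, x]) f t)%R => x cx.
have [] := @continuous_FTC1_closed R f c x (x + 1) _ _ cx (cf x).
- by rewrite ltrDl.
- exact: continuous_integrable_segment.
- by move=> dF Fx; have := derivableP dF; rewrite -derive1E Fx.
Qed.

Lemma Rintegral_derive (a b : R) f F : a < b -> continuous f ->
  (forall x, x \in `[a, b] -> is_derive x 1 F (f x)) ->
  (\int[mu]_(x in `[a, b]) f x)%R = F b - F a.
Proof.
move=> ab cf dF.
have cF x : x \in `[a, b] -> {for x, continuous F}.
  by move=> xab; apply/differentiable_continuous/derivable1_diffP;
    have [] := dF _ xab.
rewrite /Rintegral (@continuous_FTC2 _ f F)//.
- exact: continuous_subspaceT.
- split.
  + by move=> x xab; have [] := dF _ (subset_itv_oo_cc xab).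
  + by apply: cvg_at_right_filter; apply: cF; rewrite in_itv/= lexx ltW.
  + by apply: cvg_at_left_filter; apply: cF; rewrite in_itv/= lexx ltW.
- move=> x xab; rewrite derive1E.
  by have := dF _ (subset_itv_oo_cc xab) => dFx; rewrite derive_val.
Qed.

(** The two windows differ by [0, a] and [1, 1 + a]; [phi] vanishes on the latter, so only an
    interval of length [a] counts. *)
Lemma Rintegral_shift_bound (phi : R -> R) (a C : R) : 0 < a <= 1 ->
  continuous phi -> (forall v, 1 <= v -> phi v = 0) ->
  (forall v, `|phi v| <= C) ->
  `|(\int[mu]_(u in `[0, 1]) phi (u + a))%R -
    (\int[mu]_(u in `[0, 1]) phi u)%R| <= C * a.
Proof.
move=> /andP[a0 a1] cphi phi0 phiC.
(* Starting the primitive at -1 makes it differentiable on both sides at 0. *)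
have [F dF] := primitive_exists (- 1) phi cphi.
have cF x : - 1 < x -> {for x, continuous F}.
  by move=> x1; apply/differentiable_continuous/derivable1_diffP;
    have [] := dF _ x1.
have incr p q : 0 <= p -> p < q -> exists2 c, c \in `]p, q[ &
    F q - F p = phi c * (q - p).
  move=> p0 pq; apply: MVT => //.
    by move=> x; rewrite in_itv/= => /andP[px _]; apply: dF; lra.
  apply: continuous_in_subspaceT => x.
  by rewrite inE/= in_itv/= => /andP[px _]; apply: cF; lra.
have -> : (\int[mu]_(u in `[0, 1]) phi u)%R = F 1 - F 0.
  apply: Rintegral_derive => // x.
  by rewrite in_itv/= => /andP[px _]; apply: dF; lra.
have -> : (\int[mu]_(u in `[0, 1]) phi (u + a))%R = F (1 + a) - F (0 + a).
  apply: (@Rintegral_derive 0 1 (fun u => phi (u + a)) (fun u => F (u + a)))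
    => //.
  - have ca : continuous (fun u : R => u + a).
      by move=> z; apply: continuousD; [exact: cvg_id|exact: cvg_cst].
    by move=> x; apply: (continuous_comp (ca x)); exact: cphi.
  - move=> x; rewrite in_itv/= => /andP[px _].
    have xa : -1 < x + a by lra.
    have dFx := dF _ xa.
    have dg : is_derive x 1 (fun u : R => u + a) 1.
      by have := is_deriveD (is_derive_id x 1) (is_derive_cst a x 1); rewrite addr0.
    by have := @is_derive1_comp R F (+%R^~ a) x _ _ dFx dg; rewrite mulr1.
have [c _ E1] := incr 0 a (lexx 0) a0.
have [|d + E2] := incr 1 (1 + a) (ltW ltr01); first lra.
rewrite in_itv/= => /andP[d1 _].
move: E2; rewrite phi0 ?(ltW d1)// mul0r => E2.
have -> : F (1 + a) - F (0 + a) - (F 1 - F 0) = - (phi c * a).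
  by rewrite add0r; move: E1; rewrite subr0 => <-; lra.
by rewrite normrN normrM (gtr0_norm a0) ler_wpM2r// ltW.
Qed.

End RealIntegral.

(** * Near-additive functions of one variable *)

Section NearAdditive.
Context {R : realType}.
Implicit Types (g : R -> R) (C beta : R).

(** The ratio is 2/3 and not 1/2 because of odd [n]; it is attained at n = 3, split as 1 + 2. *)
Lemma halves (n : nat) : (0 < n)%N -> n != 1%N -> exists n1 n2 : nat,
  [/\ (n1 + n2)%N = n, (0 < n1)%N /\ (0 < n2)%N, (n1 < n)%N /\ (n2 < n)%N &
      (3 * n1 <= 2 * n)%N /\ (3 * n2 <= 2 * n)%N].
Proof. by move=> n0 n1; exists n./2, (n - n./2)%N; split; lia. Qed.

(* Halving n repeatedly costs at each level a fixed fraction [(2/3)^(beta-1)] of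
   the previous error, hence a geometric series. *)
Lemma near_additive_natmul g C beta : 1 < beta -> 0 <= C ->
  (forall a b, 0 < a -> 0 < b -> a + b <= 1 ->
    `|g (a + b) - g a - g b| <= C * (a + b) `^ beta) ->
  exists2 K, 0 <= K & forall (n : nat) b, (0 < n)%N -> 0 < b -> n%:R * b <= 1 ->
    `|g (n%:R * b) - n%:R * g b| <= K * (n%:R * b) `^ beta.
Proof.
move=> beta1 C0 gadd.
pose q : R := (2 / 3) `^ (beta - 1).
have q1 : q < 1.
  have -> : 1 = 1 `^ (beta - 1) :> R by rewrite powR1.
  by rewrite gt0_ltr_powR ?nnegrE; lra.
pose K := C / (1 - q).
have K0 : 0 <= K by rewrite divr_ge0// subr_ge0 ltW.
have KE : C + K * q = K.
  have q1' : 1 - q != 0 by rewrite subr_eq0 eq_sym lt_eqF.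
  by rewrite /K; field.
exists K => // n; elim/ltn_ind: n => n IH b n0 b0 nb1.
have [->|n1] := eqVneq n 1%N.
  by rewrite !mul1r subrr normr0 mulr_ge0 ?powR_ge0.
have [n1' [n2' [nE [n1'0 n2'0] [n1n n2n] [h1 h2]]]] := halves _ n0 n1.
have n12 : n%:R = n1'%:R + n2'%:R :> R by rewrite -natrD nE.
have p23 : 0 <= 2 / 3 :> R by lra.
have nbge0 : 0 <= n%:R * b by rewrite mulr_ge0// ltW.
(* One factor [k * b] is kept apart: the two parts add up to [n * b], so the sum of their errors is
   at most [q] times the error allowed for [n]. *)
have small k : (0 < k)%N -> (3 * k <= 2 * n)%N ->
    (k%:R * b) `^ beta <= (k%:R * b) * (q * (n%:R * b) `^ (beta - 1)).
  move=> k0 kn.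
  have kb0 : 0 < k%:R * b by rewrite mulr_gt0// ltr0n.
  rewrite -(@mulr_powRB1 _ (k%:R * b)) ?(ltW kb0)//; last lra.
  rewrite ler_wpM2l ?(ltW kb0)// /q -(powRM _ p23 nbge0).
  rewrite ge0_ler_powR ?nnegrE ?(ltW kb0) ?mulr_ge0 ?(ltW b0)//; first lra.
  rewrite mulrA ler_wpM2r ?(ltW b0)//.
  have : (3 * k)%:R <= (2 * n)%:R :> R by rewrite ler_nat.
  by rewrite !natrM; lra.
have s1 := small n1' n1'0 h1.
have s2 := small n2' n2'0 h2.
have nb0 : 0 < n%:R * b by rewrite mulr_gt0// ltr0n.
have p1 : 0 < n1'%:R * b by rewrite mulr_gt0// ltr0n.
have p2 : 0 < n2'%:R * b by rewrite mulr_gt0// ltr0n.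
have nbE : n%:R * b = n1'%:R * b + n2'%:R * b by rewrite n12 mulrDl.
have I1 : `|g (n1'%:R * b) - n1'%:R * g b| <= K * (n1'%:R * b) `^ beta.
  by apply: IH => //; lra.
have I2 : `|g (n2'%:R * b) - n2'%:R * g b| <= K * (n2'%:R * b) `^ beta.
  by apply: IH => //; lra.
have I3 := gadd _ _ p1 p2 ltac:(by rewrite -nbE).
rewrite -nbE in I3.
have -> : g (n%:R * b) - n%:R * g b =
    (g (n%:R * b) - g (n1'%:R * b) - g (n2'%:R * b)) +
    (g (n1'%:R * b) - n1'%:R * g b) + (g (n2'%:R * b) - n2'%:R * g b).
  by rewrite n12; ring.
apply: (le_trans (ler_normD _ _)); apply: (le_trans (lerD (ler_normD _ _) I2)).
apply: (le_trans (lerD (lerD I3 I1) (lexx _))).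
rewrite -[leRHS](@congr1 _ _ (fun z => z * (n%:R * b) `^ beta) _ _ KE) mulrDl.
rewrite -addrA lerD2l -mulrDr -mulrA ler_wpM2l//.
apply: (le_trans (lerD s1 s2)).
rewrite -mulrDl -nbE mulrCA mulr_powRB1 ?(ltW nb0)//; lra.
Qed.

(** Cauchy criterion at 0. Near-additivity compares [g a] with multiples of [g b]; the bound by
    [a ^ gamma] absorbs the fact that [a / b] is not an integer. *)
Lemma near_additive_cvg g C beta gamma : 1 < beta -> 0 < gamma -> 0 <= C ->
  (forall a b, 0 < a -> 0 < b -> a + b <= 1 ->
    `|g (a + b) - g a - g b| <= C * (a + b) `^ beta) ->
  (forall a, 0 < a <= 1 -> `|g a| <= C * a `^ gamma) ->
  cvg (e^-1 * g e @[e --> 0^'+]).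
Proof.
move=> beta1 gamma0 C0 gadd gbnd.
have [K K0 gmul] := near_additive_natmul _ _ _ beta1 C0 gadd.
have key a b : 0 < b -> b < a -> a <= 1 ->
    `|a^-1 * g a - b^-1 * g b| <=
    (K + C) * a `^ (beta - 1) + a^-1 * (2 * C * b `^ gamma).
  move=> b0 ba a1.
  have a0 : 0 < a by exact: lt_trans ba.
  (* The leftover time [a - n * b] is at most [b] and the fractional part of [a / b] is less than 1:
     each costs at most [C * b ^ gamma]. *)
  pose n := Num.truncn (a / b).
  have ab0 : 0 <= a / b by rewrite divr_ge0// ltW.
  have /andP[nle nlt] := truncn_itv ab0; rewrite -/n in nle nlt.
  have n0 : (0 < n)%N.
    rewrite lt0n; apply/eqP => n0; move: nlt; rewrite n0 ltr_pdivrMr// mul1r.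
    by rewrite ltNge (ltW ba).
  have nba : n%:R * b <= a by rewrite -ler_pdivlMr.
  have anb : a < n%:R * b + b.
    by move: nlt; rewrite ltr_pdivrMr// -natr1 mulrDl mul1r.
  have nb0 : 0 < n%:R * b by rewrite mulr_gt0// ltr0n.
  have nb1 : n%:R * b <= 1 by exact: le_trans a1.
  have bp : 0 <= b `^ gamma by exact: powR_ge0.
  have ap : 0 <= a `^ beta by exact: powR_ge0.
  have gb : `|g b| <= C * b `^ gamma by apply: gbnd; rewrite b0/=; lra.
  have mono : (n%:R * b) `^ beta <= a `^ beta.
    by rewrite ge0_ler_powR ?nnegrE ?(ltW nb0) ?(ltW a0)//; lra.
  have E1 : `|g a - g (n%:R * b)| <= C * a `^ beta + C * b `^ gamma.
    move: nba; rewrite le_eqVlt => /predU1P[->|nba].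
      by rewrite subrr normr0 addr_ge0// mulr_ge0.
    pose r := a - n%:R * b.
    have r0 : 0 < r by rewrite /r; lra.
    have rb : r <= b by rewrite /r; lra.
    have gr : `|g r| <= C * b `^ gamma.
      apply: (@le_trans _ _ (C * r `^ gamma)).
        by apply: gbnd; rewrite r0/= /r; lra.
      by rewrite ler_wpM2l// ge0_ler_powR ?nnegrE ?(ltW r0) ?(ltW b0) ?(ltW gamma0).
    have := gadd (n%:R * b) r nb0 r0 ltac:(rewrite /r; lra).
    have -> : n%:R * b + r = a by rewrite /r; ring.
    move=> G; have -> : g a - g (n%:R * b) = (g a - g (n%:R * b) - g r) + g r.
      by ring.
    by apply: (le_trans (ler_normD _ _)); exact: lerD.
  have E2 : `|g (n%:R * b) - n%:R * g b| <= K * a `^ beta.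
    by apply: (le_trans (gmul _ _ n0 b0 nb1)); rewrite ler_wpM2l.
  have E3 : `|(n%:R - a / b) * g b| <= C * b `^ gamma.
    rewrite normrM -[leRHS]mul1r ler_pM// ler0_norm ?subr_le0//.
    by move: nlt; rewrite -natr1; lra.
  have -> : a^-1 * g a - b^-1 * g b = a^-1 * ((g a - g (n%:R * b)) +
      (g (n%:R * b) - n%:R * g b) + (n%:R - a / b) * g b).
    by field; rewrite !gt_eqF.
  rewrite normrM gtr0_norm ?invr_gt0//.
  have -> : (K + C) * a `^ (beta - 1) = a^-1 * ((K + C) * a `^ beta).
    have -> : a `^ beta = a * a `^ (beta - 1).
      by rewrite mulr_powRB1 ?(ltW a0)//; lra.
    by field; rewrite gt_eqF.
  rewrite -mulrDr ler_wpM2l ?invr_ge0 ?(ltW a0)//.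
  apply: (le_trans (ler_normD _ _)); apply: (le_trans (lerD (ler_normD _ _) E3)).
  apply: (le_trans (lerD (lerD E1 E2) (lexx _))); lra.
have small (p e : R) : 0 < p -> 0 < e -> \forall b \near (0:R)^'+, b `^ p < e.
  move=> p0 e0; near=> b.
  have b0 : 0 < b by near: b; exact: nbhs_right_gt.
  have be : b < e `^ p^-1.
    by near: b; apply: nbhs_right_lt; rewrite powR_gt0.
  have -> : e = (e `^ p^-1) `^ p by rewrite -powRrM mulVf ?gt_eqF// powRr1 ?ltW.
  by rewrite gt0_ltr_powR ?nnegrE ?powR_ge0// ltW.
apply: cauchy_cvg; apply: cauchy_exP => e e0.
(* [a] is fixed first and [b] tends to 0 afterwards, since the second error in [key] carries
   [a^-1]. *)
have [a [a0 a1 asmall]] : exists a : R, [/\ 0 < a, a <= 1 &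
    (K + C) * a `^ (beta - 1) < e / 2].
  have KC1 : 0 < K + C + 1 by lra.
  have b10 : 0 < beta - 1 by lra.
  have e20 : 0 < e / 2 / (K + C + 1) by rewrite !divr_gt0.
  have : \forall a \near (0:R)^'+, [/\ 0 < a, a <= 1 &
      (K + C) * a `^ (beta - 1) < e / 2].
    near=> a; split.
    - by near: a; exact: nbhs_right_gt.
    - by near: a; apply: nbhs_right_le; exact: ltr01.
    - apply: (@le_lt_trans _ _ ((K + C + 1) * a `^ (beta - 1))).
        by rewrite ler_wpM2r ?powR_ge0//; lra.
      rewrite mulrC -ltr_pdivlMr//; near: a; exact: small.
  by move=> /filter_ex.
have c0 : 0 < e / 2 * a by rewrite mulr_gt0// divr_gt0.
have C1 : 0 < 2 * C + 1 by lra.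
have c1 : 0 < e / 2 * a / (2 * C + 1) by rewrite divr_gt0.
exists (a^-1 * g a).
suff : \forall b \near (0:R)^'+, ball (a^-1 * g a) e (b^-1 * g b) by [].
near=> b.
have b0 : 0 < b by near: b; exact: nbhs_right_gt.
have ba : b < a by near: b; exact: nbhs_right_lt.
rewrite /= /ball/=; apply: (le_lt_trans (key _ _ b0 ba a1)).
suff : a^-1 * (2 * C * b `^ gamma) < e / 2 by lra.
rewrite mulrC ltr_pdivrMr//.
apply: (@le_lt_trans _ _ ((2 * C + 1) * b `^ gamma)).
  by rewrite ler_wpM2r ?powR_ge0//; lra.
rewrite mulrC -ltr_pdivlMr//; near: b; exact: small.
Unshelve. all: by end_near. Qed.

End NearAdditive.

(** * Averages of near-additive germs *)

Section Average.
Context {R : realType}.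
Local Notation mu := (@lebesgue_measure R).

Lemma Rintegral01_bound (phi : R -> R) (B : R) : continuous phi ->
  (forall u, u \in `[0, 1] -> `|phi u| <= B) ->
  `|(\int[mu]_(u in `[0, 1]) phi u)%R| <= B.
Proof.
move=> cphi phiB.
have iphi := continuous_integrable_segment 0 1 _ cphi.
have cn : continuous (fun u => `|phi u|).
  by move=> u; apply: continuous_comp; [exact: cphi|exact: norm_continuous].
have in_ := continuous_integrable_segment 0 1 _ cn.
have ib : mu.-integrable `[0, 1] (EFin \o (fun=> B)).
  by apply: continuous_integrable_segment => u; exact: cvg_cst.
apply: (le_trans (le_normr_Rintegral _ iphi)) => //.
apply: (@le_trans _ _ (\int[mu]_(u in `[0%R, 1%R]) B)%R).
  by apply: le_Rintegral => //= u u01; exact: phiB.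
rewrite Rintegral_cst//= lebesgue_measure_itv/= lte_fin ltr01.
by rewrite -EFinB/= subr0 mulr1.
Qed.

(** Integrating the defect of [j] in [u] leaves the second germ over a window shifted by [a]. Since
    [j] vanishes beyond 1, undoing the shift costs [C * b ^ gamma * a], at most
    [C * (a + b) ^ (1 + gamma)]; hence the condition [beta <= 1 + gamma]. *)
Lemma averaged_germ_cvg (j : R -> R -> R) (C beta gamma : R) :
  1 < beta -> beta <= 1 + gamma -> 0 < gamma -> 0 <= C ->
  (forall e, 0 < e -> continuous (fun u => j u (u + e))) ->
  (forall s t, s < t -> t <= s + 1 -> `|j s t| <= C * (t - s) `^ gamma) ->
  (forall s u t, s < u -> u < t -> t <= s + 1 ->
    `|j s u + j u t - j s t| <= C * (t - s) `^ beta) ->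
  (forall s t, 1 <= s -> s < t -> j s t = 0) ->
  cvg (e^-1 * (\int[mu]_(u in `[0, 1]) j u (u + e))%R @[e --> 0^'+]).
Proof.
move=> beta1 betag gamma0 C0 cj jbnd jadd j0.
apply: (@near_additive_cvg R (fun e => (\int[mu]_(u in `[0, 1]) j u (u + e))%R)
  (2 * C) beta gamma) => //; first lra.
  move=> a b a0 b0 ab1.
  have cs : continuous (fun u => j (u + a) (u + a + b)).
    have ca : continuous (fun u : R => u + a).
      by move=> z; apply: continuousD; [exact: cvg_id|exact: cvg_cst].
    by move=> x; exact: (continuous_comp (ca x) (cj b b0 _)).
  have ab0 : 0 < a + b by lra.
  have iS := continuous_integrable_segment 0 1 _ cs.
  have iA := continuous_integrable_segment 0 1 _ (cj a a0).
  have iAB := continuous_integrable_segment 0 1 _ (cj _ ab0).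
  have sh := @Rintegral_shift_bound R (fun v => j v (v + b)) a (C * b `^ gamma).
  have {sh}E2 : `|(\int[mu]_(u in `[0, 1]) j (u + a) (u + a + b))%R -
      (\int[mu]_(u in `[0, 1]) j u (u + b))%R| <= C * (a + b) `^ beta.
    apply: le_trans.
      apply: sh; [lra|exact: cj|by move=> v v1; apply: j0 => //; lra|].
      move=> v; have := jbnd v (v + b); rewrite (_ : v + b - v = b); last by ring.
      by apply; lra.
    rewrite -mulrA ler_wpM2l//.
    apply: (@le_trans _ _ ((a + b) `^ (1 + gamma))).
      rewrite powRD; last by apply/implyP => _; rewrite gt_eqF.
      rewrite powRr1 ?(ltW ab0)// mulrC ler_pM ?powR_ge0 ?(ltW a0)//; first lra.
      by rewrite ge0_ler_powR ?nnegrE ?(ltW gamma0) ?(ltW ab0) ?(ltW b0)//; lra.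
    by apply: ger_powR => //; rewrite ab0.
  have E1 : `|(\int[mu]_(u in `[0, 1]) (j u (u + (a + b)) - (j u (u + a) +
      j (u + a) (u + a + b))))%R| <= C * (a + b) `^ beta.
    apply: Rintegral01_bound => [u|u _].
      apply: cvgB; first exact: (cj _ ab0).
      by apply: cvgD; [exact: (cj _ a0)|exact: cs].
    rewrite distrC addrA.
    have := jadd u (u + a) (u + a + b).
    have -> : u + a + b - u = a + b by ring.
    by apply; lra.
  move: E1; rewrite RintegralB//; last first.
    apply: continuous_integrable_segment => u.
    by apply: cvgD; [exact: (cj _ a0)|exact: cs].
  rewrite RintegralD// => E1.
  set X := (\int[mu]_(u in _) j u (u + (a + b)))%R in E1 *.
  set Y := (\int[mu]_(u in _) j u (u + a))%R in E1 *.
  set Z := (\int[mu]_(u in _) j (u + a) _)%R in E1 E2.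
  set T := (\int[mu]_(u in _) j u (u + b))%R in E2 *.
  have -> : X - Y - T = (X - (Y + Z)) + (Z - T) by ring.
  by apply: (le_trans (ler_normD _ _)); lra.
move=> a /andP[a0 a1]; apply: Rintegral01_bound => [|u _]; first exact: cj.
have := jbnd u (u + a); rewrite (_ : u + a - u = a); last by ring.
move=> H; apply: (le_trans (H _ _)); [lra..|].
by rewrite ler_wpM2r ?powR_ge0//; lra.
Qed.

End Average.

(** * Areas and moments of triangles *)

Section Triangle.
Context {R : realType}.
Local Notation mu := (@lebesgue_measure R).
Implicit Types p q r : R * R.

Lemma signed_areaC p q r : signed_area q p r = - signed_area p q r.
Proof. rewrite /signed_area; ring. Qed.

Lemma signed_areaAC p q r : signed_area p r q = - signed_area p q r.
Proof. rewrite /signed_area; ring. Qed.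

Lemma triangleC p q r : triangle q p r = triangle p q r.
Proof.
apply/seteqP; split => v [a [b [c [a0 b0 c0 abc ->]]]].
  by exists b, a, c; split => //; [lra|congr (_, _); ring].
by exists b, a, c; split => //; [lra|congr (_, _); ring].
Qed.

Lemma triangleAC p q r : triangle p r q = triangle p q r.
Proof.
apply/seteqP; split => v [a [b [c [a0 b0 c0 abc ->]]]].
  by exists a, c, b; split => //; [lra|congr (_, _); ring].
by exists a, c, b; split => //; [lra|congr (_, _); ring].
Qed.

(** Dividing by [D] treats both orientations of the triangle at once: the sign of [D] decides which
    of [e], [f] is the lower end. *)
Lemma measure_between (D e f : R) : D != 0 -> 0 <= (f - e) / D ->
  mu [set z | 0 <= (z - e) / D /\ 0 <= (f - z) / D] = `|f - e|%:E.
Proof.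
move=> D0 ef.
have [Dgt|Dlt] := orP (lt_total D0).
- have -> : [set z | 0 <= (z - e) / D /\ 0 <= (f - z) / D] = `[f, e]%classic.
    apply/seteqP; split => z /=; rewrite in_itv/= !ler_ndivlMr ?mul0r ?subr_le0//.
      by move=> [-> ->].
    by move=> /andP[-> ->].
  move: ef; rewrite ler_ndivlMr// mul0r subr_le0 => ef.
  rewrite lebesgue_measure_itv/= lte_fin ler0_norm ?subr_le0// opprB.
  case: ltP => //= fe.
  by rewrite (le_anti (introT andP (conj ef fe))) subrr.
- have -> : [set z | 0 <= (z - e) / D /\ 0 <= (f - z) / D] = `[e, f]%classic.
    apply/seteqP; split => z /=; rewrite in_itv/= !ler_pdivlMr ?mul0r ?subr_ge0//.
      by move=> [-> ->].
    by move=> /andP[-> ->].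
  move: ef; rewrite ler_pdivlMr// mul0r subr_ge0 => ef.
  rewrite lebesgue_measure_itv/= lte_fin ger0_norm ?subr_ge0//.
  case: ltP => //= fe.
  by rewrite (le_anti (introT andP (conj ef fe))) subrr.
Qed.

(* The three quotients are the barycentric coordinates of [v], and
   [signed_area p q r *- 2] is the determinant of (q - p, r - p). *)
Lemma triangle_bary p q r : signed_area p q r != 0 ->
  triangle p q r = [set v |
    0 <= ((r.1 - q.1) * (v.2 - q.2) - (r.2 - q.2) * (v.1 - q.1)) /
         (signed_area p q r *- 2) /\
    0 <= ((v.1 - p.1) * (r.2 - p.2) - (v.2 - p.2) * (r.1 - p.1)) /
         (signed_area p q r *- 2) /\
    0 <= ((q.1 - p.1) * (v.2 - p.2) - (q.2 - p.2) * (v.1 - p.1)) /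
         (signed_area p q r *- 2)].
Proof.
move=> A0; set D := signed_area p q r *- 2.
have D0 : D != 0 by rewrite /D oppr_eq0 mulrn_eq0.
have DE : D = (q.1 - p.1) * (r.2 - p.2) - (q.2 - p.2) * (r.1 - p.1).
  by rewrite /D /signed_area; field.
apply/seteqP; split => v.
  move=> [a [b [c [a0 b0 c0 abc ->]]]] /=.
  have aE : a = 1 - b - c by lra.
  rewrite (_ : _ / D = a); last by rewrite aE DE; field; rewrite -DE.
  rewrite (_ : _ / D = b); last by rewrite aE DE; field; rewrite -DE.
  by rewrite (_ : _ / D = c) //; rewrite aE DE; field; rewrite -DE.
move=> [a0 [b0 c0]]; do 3 eexists; split; [exact: a0|exact: b0|exact: c0|..].
  by rewrite DE; field; rewrite -DE.
case: v {a0 b0 c0} => v1 v2; congr (_, _) => /=.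
  by rewrite DE; field; rewrite -DE.
by rewrite DE; field; rewrite -DE.
Qed.

Lemma measurable_half_plane (a b c : R) :
  measurable [set v : measurableTypeR R * measurableTypeR R |
     0 <= a * (v.1 : R) + b * (v.2 : R) + c].
Proof.
rewrite [X in measurable X](_ : _ = setT `&`
  (fun v : measurableTypeR R * measurableTypeR R => 
     a * (v.1 : R) + b * (v.2 : R) + c) @^-1` `[0, +oo[%classic); last first.
  by apply/seteqP; split => v /=; rewrite in_itv/= andbT; [move=> ?; split|case].
have mf : measurable_fun setT (fun v : measurableTypeR R * measurableTypeR R =>
    a * (v.1 : R) + b * (v.2 : R) + c).
  apply: measurable_funD => //; apply: measurable_funD.
    by apply: measurable_funM => //; exact: measurable_fst.
  by apply: measurable_funM => //; exact: measurable_snd.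
by apply: mf => //; exact: measurable_itv.
Qed.

Lemma measurable_triangle p q r : signed_area p q r != 0 ->
  measurable (triangle p q r : set (measurableTypeR R * measurableTypeR R)).
Proof.
move=> A0; rewrite triangle_bary//; set D := signed_area p q r *- 2.
apply: measurableI.
  rewrite [X in measurable X](_ : _ = [set v | 0 <= (- (r.2 - q.2) / D) * v.1 +
    ((r.1 - q.1) / D) * v.2 + ((r.2 - q.2) * q.1 - (r.1 - q.1) * q.2) / D]).
    exact: measurable_half_plane.
  by apply/seteqP; split => v /=; congr (_ <= _); ring.
apply: measurableI.
  rewrite [X in measurable X](_ : _ = [set v | 0 <= ((r.2 - p.2) / D) * v.1 +
    (- (r.1 - p.1) / D) * v.2 + ((r.1 - p.1) * p.2 - (r.2 - p.2) * p.1) / D]).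
    exact: measurable_half_plane.
  by apply/seteqP; split => v /=; congr (_ <= _); ring.
rewrite [X in measurable X](_ : _ = [set v | 0 <= (- (q.2 - p.2) / D) * v.1 +
    ((q.1 - p.1) / D) * v.2 + ((q.2 - p.2) * p.1 - (q.1 - p.1) * p.2) / D]).
  exact: measurable_half_plane.
by apply/seteqP; split => v /=; congr (_ <= _); ring.
Qed.

End Triangle.

(** * Lengths of the vertical sections of a triangle *)

Section TriangleMeasure.
Context {R : realType}.
Local Notation mu := (@lebesgue_measure R).
Implicit Types p q r : R * R.

Lemma integral_linear (a b c k : R) : a <= b ->
  (\int[mu]_(x in `[a, b]) ((x - c) * k)%:E =
   (((b - c) ^+ 2 - (a - c) ^+ 2) * k / 2)%:E)%E.
Proof.
rewrite le_eqVlt => /predU1P[->|ab].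
  by rewrite set_itv1 integral_set1 subrr !mul0r.
have cf : continuous (fun x : R => (x - c) * k).
  move=> x; apply: cvgM; last exact: cvg_cst.
  by apply: cvgB; [exact: cvg_id|exact: cvg_cst].
have H : (\int[mu]_(x in `[a, b]) ((x - c) * k))%R =
    (b - c) ^+ 2 * (k / 2) - (a - c) ^+ 2 * (k / 2).
  apply: (@Rintegral_derive R a b _ (fun x => (x - c) ^+ 2 * (k / 2))) => //.
  move=> x _; apply: is_derive_eq.
  by rewrite /GRing.scale/=; field.
have fin : (\int[mu]_(x in `[a, b]) ((x - c) * k)%:E)%E \is a fin_num.
  apply: integrable_fin_num => //.
  exact: (continuous_integrable_segment a b _ cf).
by move: H; rewrite -(fineK fin) /Rintegral => ->; congr (_%:E); ring.
Qed.

(** To the left of [q] a vertical line meets the triangle between the edges [pq] and [pr], so two of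
    the three barycentric inequalities decide and the third follows. *)
Lemma mu_xsection_left p q r (xi : R) : signed_area p q r != 0 ->
  q.1 <= r.1 -> p.1 <= xi < q.1 ->
  mu (xsection (triangle p q r) xi) =
  ((xi - p.1) / (q.1 - p.1) * (`|signed_area p q r *- 2| / (r.1 - p.1)))%:E.
Proof.
move=> A0 qr /andP[pxi xiq]; have TE := triangle_bary _ _ _ A0.
have D0 : signed_area p q r *- 2 != 0 by rewrite oppr_eq0 mulrn_eq0.
have DE : signed_area p q r *- 2 =
    (q.1 - p.1) * (r.2 - p.2) - (q.2 - p.2) * (r.1 - p.1).
  by rewrite /signed_area; field.
move: (signed_area p q r *- 2) D0 DE TE => D D0 DE ->.
have pq : 0 < q.1 - p.1 by lra.
have pr : 0 < r.1 - p.1 by lra.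
(* [e] and [f] are the ordinates at [xi] of the lines [pq] and [pr]. *)
pose e := p.2 + (xi - p.1) / (q.1 - p.1) * (q.2 - p.2).
pose f := p.2 + (xi - p.1) / (r.1 - p.1) * (r.2 - p.2).
have efE : f - e = (xi - p.1) / (q.1 - p.1) * (D / (r.1 - p.1)).
  by rewrite /e /f DE; field; rewrite !gt_eqF.
have t0 : 0 <= (xi - p.1) / (q.1 - p.1) by apply: divr_ge0; lra.
rewrite (_ : xsection _ xi =
    [set z | 0 <= (z - e) / D /\ 0 <= (f - z) / D]); last first.
  apply/seteqP; split => z.
    rewrite /xsection/= inE/= => -[_ []].
    rewrite (_ : _ / D = (f - z) / D * (r.1 - p.1)); last first.
      by rewrite /f; field; rewrite D0 gt_eqF.
    rewrite pmulr_lge0// => -> .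
    rewrite (_ : _ / D = (z - e) / D * (q.1 - p.1)); last first.
      by rewrite /e; field; rewrite D0 gt_eqF.
    by rewrite pmulr_lge0// => ->.
  move=> /= [ze fz]; rewrite /xsection/= inE/=.
  set b := ((xi - _) * _ - _) / D; set c := (_ * (z - p.2) - _) / D.
  have bE : b = (f - z) / D * (r.1 - p.1).
    by rewrite /b /f; field; rewrite D0 gt_eqF.
  have cE : c = (z - e) / D * (q.1 - p.1).
    by rewrite /c /e; field; rewrite D0 gt_eqF.
  have b0 : 0 <= b by rewrite bE pmulr_lge0.
  have c0 : 0 <= c by rewrite cE pmulr_lge0.
  split => //; rewrite (_ : _ / D = 1 - b - c); last first.
    by rewrite /b /c DE; field; rewrite -DE.
  (* As [q.1 <= r.1] and [xi < q.1], this identity forces [b + c <= 1], so the first coordinate is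
     nonnegative. *)
  have H : xi - p.1 = b * (q.1 - p.1) + c * (r.1 - p.1).
    by rewrite /b /c DE; field; rewrite -DE.
  rewrite -addrA -opprD subr_ge0 -(ler_pM2r pq) mul1r.
  by apply: (@le_trans _ _ (xi - p.1)); [rewrite H mulrDl lerD2l ler_wpM2l//|]; lra.
rewrite measure_between//.
  rewrite efE normrM (ger0_norm t0) normf_div.
  by rewrite (gtr0_norm pr).
by rewrite efE !mulrA mulrAC mulfK// divr_ge0// ltW.
Qed.

Lemma mu_xsection_right p q r (xi : R) : signed_area p q r != 0 ->
  p.1 <= q.1 -> q.1 < xi <= r.1 ->
  mu (xsection (triangle p q r) xi) =
  ((r.1 - xi) / (r.1 - q.1) * (`|signed_area p q r *- 2| / (r.1 - p.1)))%:E.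
Proof.
move=> A0 pq' /andP[pxi xiq]; have TE := triangle_bary _ _ _ A0.
have D0 : signed_area p q r *- 2 != 0 by rewrite oppr_eq0 mulrn_eq0.
have DE : signed_area p q r *- 2 =
    (q.1 - p.1) * (r.2 - p.2) - (q.2 - p.2) * (r.1 - p.1).
  by rewrite /signed_area; field.
move: (signed_area p q r *- 2) D0 DE TE => D D0 DE ->.
have qr : 0 < r.1 - q.1 by lra.
have pr : 0 < r.1 - p.1 by lra.
(* To the right of [q] the section is bounded by the lines [qr] and [pr]. *)
pose e := q.2 + (xi - q.1) / (r.1 - q.1) * (r.2 - q.2).
pose f := p.2 + (xi - p.1) / (r.1 - p.1) * (r.2 - p.2).
have efE : f - e = (r.1 - xi) / (r.1 - q.1) * (D / (r.1 - p.1)).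
  by rewrite /e /f DE; field; rewrite !gt_eqF.
have t0 : 0 <= (r.1 - xi) / (r.1 - q.1) by apply: divr_ge0; lra.
rewrite (_ : xsection _ xi =
    [set z | 0 <= (z - e) / D /\ 0 <= (f - z) / D]); last first.
  apply/seteqP; split => z.
    rewrite /xsection/= inE/= => -[+ [+ _]].
    rewrite (_ : _ / D = (z - e) / D * (r.1 - q.1)); last first.
      by rewrite /e; field; rewrite D0 gt_eqF.
    rewrite pmulr_lge0// => -> .
    rewrite (_ : _ / D = (f - z) / D * (r.1 - p.1)); last first.
      by rewrite /f; field; rewrite D0 gt_eqF.
    by rewrite pmulr_lge0// => ->.
  move=> /= [ze fz]; rewrite /xsection/= inE/=.
  set a := (_ * (z - q.2) - _) / D; set b := ((xi - _) * _ - _) / D.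
  have bE : b = (f - z) / D * (r.1 - p.1).
    by rewrite /b /f; field; rewrite D0 gt_eqF.
  have aE : a = (z - e) / D * (r.1 - q.1).
    by rewrite /a /e; field; rewrite D0 gt_eqF.
  have b0 : 0 <= b by rewrite bE pmulr_lge0.
  have a0 : 0 <= a by rewrite aE pmulr_lge0.
  split => //; split => //; rewrite (_ : _ / D = 1 - a - b); last first.
    by rewrite /b /a DE; field; rewrite -DE.
  have H : r.1 - xi = a * (r.1 - p.1) + b * (r.1 - q.1).
    by rewrite /b /a DE; field; rewrite -DE.
  rewrite -addrA -opprD subr_ge0 -(ler_pM2r qr) mul1r.
  by apply: (@le_trans _ _ (r.1 - xi)); [rewrite H mulrDl lerD2r ler_wpM2l//|]; lra.
rewrite measure_between//.
  rewrite efE normrM (ger0_norm t0) normf_div.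
  by rewrite (gtr0_norm pr).
by rewrite efE !mulrA mulrAC mulfK// divr_ge0// ltW.
Qed.

Lemma triangle_fst p q r v : p.1 <= q.1 <= r.1 -> triangle p q r v ->
  p.1 <= v.1 <= r.1.
Proof.
move=> /andP[pq qr] [a [b [c [a0 b0 c0 abc ->]]]] /=.
have -> : a = 1 - b - c by lra.
by apply/andP; split; nra.
Qed.

End TriangleMeasure.

(** * Areas and moments of arbitrary triangles *)

Section TriangleMeasure.
Context {R : realType}.
Local Notation mu := (@lebesgue_measure R).
Implicit Types p q r : R * R.

(* With vertices sorted by abscissa, the length of a vertical section is linear
   on each side of the middle vertex. *)
Lemma mu_triangle_sorted p q r : p.1 <= q.1 <= r.1 -> signed_area p q r != 0 ->
  (mu \x mu)%E (triangle p q r) = `|signed_area p q r|%:E.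
Proof.
move=> pqr A0; have /andP[pq qr] := pqr.
have pr : p.1 < r.1.
  rewrite lt_neqAle (le_trans pq qr) andbT; apply: contra_neq A0 => pr.
  have pq' : q.1 = p.1 by lra.
  by rewrite /signed_area -pr pq'; ring.
(* [H] is the length of the vertical section through [q], the common base of the two triangles into
   which it cuts the original one. *)
pose H := `|signed_area p q r *- 2| / (r.1 - p.1).
pose F := fun x : measurableTypeR R => mu (xsection (triangle p q r) x).
have mF : measurable_fun setT F.
  have := @measurable_fun_xsection _ _ (measurableTypeR R) (measurableTypeR R) R
    mu (triangle p q r) (measurable_triangle _ _ _ A0).
  by [].
have F0 x : (0 <= F x)%E by [].
transitivity (\int[mu]_(x in `[p.1, r.1]) F x)%E.
  rewrite [RHS]integral_mkcond; apply: eq_integral => x _.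
  rewrite patchE; case: ifPn => // xn; rewrite /= [xsection _ _](_ : _ = set0).
    by rewrite measure0.
  apply/seteqP; split => z //=; rewrite /xsection/= inE.
  move=> /triangle_fst => /(_ pqr)/= xpr; move/negP: xn; apply.
  by rewrite inE/= in_itv/=.
rewrite (@itv_bndbnd_setU _ _ _ (BLeft q.1)) ?bnd_simp//.
rewrite ge0_integral_setU//=; last 2 first.
  - exact: measurable_funTS.
  - apply/disj_setPS => x [] /=; rewrite !in_itv/= => /andP[_ +] /andP[+ _].
    by move=> xq qx; move: (lt_le_trans xq qx); rewrite ltxx.
have -> : (\int[mu]_(x in [set` `[p.1, q.1[]) F x = ((q.1 - p.1) * H / 2)%:E)%E.
  transitivity (\int[mu]_(x in `[p.1, q.1[)
      ((x - p.1) * (H / (q.1 - p.1)))%:E)%E.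
    apply: eq_integral => x; rewrite inE/= in_itv/= => xpq.
    by rewrite /F mu_xsection_left// -/H; congr (_%:E); ring.
  rewrite integral_itv_bndo_bndc; last first.
    apply/measurable_EFinP; apply: measurable_funM => //.
    exact: measurable_funB.
  rewrite integral_linear// subrr expr0n subr0; congr (_%:E).
  have [->|qp0] := eqVneq q.1 p.1; first by rewrite subrr expr0n !mul0r.
  by field; rewrite subr_eq0.
have -> : (\int[mu]_(x in [set` `[q.1, r.1]]) F x = ((r.1 - q.1) * H / 2)%:E)%E.
  (* The formula on the right is available only for [q.1 < xi], so the null endpoint is removed and
     then restored; if [q.1 = r.1] nothing is left. *)
  rewrite -integral_itv_obnd_cbnd; last exact: measurable_funTS.
  transitivity (\int[mu]_(x in `]q.1, r.1])
      ((x - r.1) * (- H / (r.1 - q.1)))%:E)%E.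
    apply: eq_integral => x; rewrite inE/= in_itv/= => xpq.
    by rewrite /F mu_xsection_right// -/H; congr (_%:E); ring.
  rewrite integral_itv_obnd_cbnd; last first.
    apply/measurable_EFinP; apply: measurable_funM => //.
    exact: measurable_funB.
  rewrite integral_linear// subrr expr0n sub0r; congr (_%:E).
  have [->|qp0] := eqVneq q.1 r.1; first by rewrite subrr expr0n oppr0 !mul0r.
  by field; rewrite subr_eq0 eq_sym.
rewrite -EFinD; congr (_%:E); rewrite /H.
rewrite normrN normrMn -mulr_natr; field.
by rewrite subr_eq0 gt_eqF.
Qed.

Lemma mu_triangle p q r : signed_area p q r != 0 ->
  (mu \x mu)%E (triangle p q r) = `|signed_area p q r|%:E.
Proof.
have swap12 p' q' r' : (signed_area q' p' r' != 0 ->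
    (mu \x mu)%E (triangle q' p' r') = `|signed_area q' p' r'|%:E) ->
    signed_area p' q' r' != 0 ->
    (mu \x mu)%E (triangle p' q' r') = `|signed_area p' q' r'|%:E.
  by rewrite signed_areaC oppr_eq0 normrN triangleC.
have swap23 p' q' r' : (signed_area p' r' q' != 0 ->
    (mu \x mu)%E (triangle p' r' q') = `|signed_area p' r' q'|%:E) ->
    signed_area p' q' r' != 0 ->
    (mu \x mu)%E (triangle p' q' r') = `|signed_area p' q' r'|%:E.
  by rewrite signed_areaAC oppr_eq0 normrN triangleAC.
have S := mu_triangle_sorted.
have [pq|qp] := orP (le_total p.1 q.1); have [qr|rq] := orP (le_total q.1 r.1);
  have [pr|rp] := orP (le_total p.1 r.1).
- by apply: S; rewrite pq.
- by apply: S; rewrite pq.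
- by apply: (swap23); apply: S; rewrite pr.
- by apply: (swap23); apply: (swap12); apply: S; rewrite rp.
- by apply: (swap12); apply: S; rewrite qp.
- by apply: (swap12); apply: (swap23); apply: S; rewrite qr.
- by apply: (swap12); apply: S; rewrite qp.
- by apply: (swap12); apply: (swap23); apply: (swap12); apply: S; rewrite rq.
Qed.

Lemma triangle_snd_bound p q r (c d : R) v :
  `|p.2 - c| <= d -> `|q.2 - c| <= d -> `|r.2 - c| <= d ->
  triangle p q r v -> `|v.2 - c| <= d.
Proof.
rewrite !ler_norml => /andP[p1 p2] /andP[q1 q2] /andP[r1 r2].
move=> [a [b [e [a0 b0 e0 abe ->]]]] /=.
have -> : c = a * c + b * c + e * c by rewrite -!mulrDl abe mul1r.
have dE : d = a * d + b * d + e * d by rewrite -!mulrDl abe mul1r.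
have L x y : 0 <= x -> - d <= y - c -> - (x * d) <= x * (y - c).
  by move=> x0 yc; rewrite -mulrN ler_wpM2l.
have U x y : 0 <= x -> y - c <= d -> x * (y - c) <= x * d.
  by move=> x0 yc; rewrite ler_wpM2l.
have := L _ _ a0 p1; have := L _ _ b0 q1; have := L _ _ e0 r1.
have := U _ _ a0 p2; have := U _ _ b0 q2; have := U _ _ e0 r2.
by move=> *; apply/andP; split; lra.
Qed.

(** All ordinates in the triangle lie within [d] of [c], so there the integrand varies from [c ^+ k]
    by at most the factor in front of the area, while the constant [c ^+ k] integrates to the signed
    area exactly. For [k = 0] the bound is 0, so this is then an equality. *)
Lemma signed_moment_near p q r (k : nat) (c d M : R) :
  `|c| <= M -> `|p.2| <= M -> `|q.2| <= M -> `|r.2| <= M ->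
  `|p.2 - c| <= d -> `|q.2 - c| <= d -> `|r.2 - c| <= d ->
  `|signed_moment p q r k - c ^+ k * signed_area p q r| <=
    k%:R * M ^+ k.-1 * d * `|signed_area p q r|.
Proof.
move=> cM pM qM rM pc qc rc.
have [A0|A0] := eqVneq (signed_area p q r) 0.
  by rewrite /signed_moment A0 sgr0 mul0r mulr0 subrr !normr0 mulr0.
have mT := measurable_triangle _ _ _ A0.
have muT := mu_triangle _ _ _ A0.
rewrite /signed_moment; set T := triangle p q r in mT muT *.
have fineT : fine ((mu \x mu)%E T) = `|signed_area p q r| by rewrite muT.
have M0 : 0 <= M by exact: le_trans cM.
have fT : ((mu \x mu)%E T < +oo)%E by rewrite muT ltry.
have pow_near x : `|x - c| <= d -> `|x| <= M ->
    `|x ^+ k - c ^+ k| <= k%:R * M ^+ k.-1 * d.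
  move=> xc xM; rewrite subrXX normrM mulrC ler_pM//.
  apply: (le_trans (ler_norm_sum _ _ _)).
  apply: (@le_trans _ _ (\sum_(i < k) M ^+ k.-1)).
    apply: ler_sum => i _; rewrite normrM !normrX.
    have ik : (i <= k.-1)%N by rewrite -ltnS (ltn_predK (ltn_ord i)).
    rewrite -[in leRHS](subnK ik) exprD; apply: ler_pM; rewrite ?exprn_ge0//.
      by apply: lerXn2r; rewrite ?nnegrE.
    by apply: lerXn2r; rewrite ?nnegrE.
  by rewrite sumr_const card_ord mulr_natl.
have icst (e : R) : (mu \x mu)%E.-integrable T (EFin \o (fun=> e)).
  apply: measurable_bounded_integrable => //.
  exists `|e|; split; first exact: num_real.
  by move=> N eN v vT /=; exact: ltW.
have ipow : (mu \x mu)%E.-integrable T 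
    (EFin \o (fun v : measurableTypeR R * measurableTypeR R => (v.2 : R) ^+ k)).
  apply: measurable_bounded_integrable => //.
    apply: measurable_funTS; apply: measurable_funX; exact: measurable_snd.
  exists (M ^+ k); split; first exact: num_real.
  move=> N MN v vT /=; apply: (le_trans _ (ltW MN)); rewrite normrX.
  rewrite lerXn2r ?nnegrE//.
  by have := @triangle_snd_bound p q r 0 M v; rewrite !subr0; apply.
have -> : c ^+ k * signed_area p q r = Num.sg (signed_area p q r) *
    (\int[(mu \x mu)%E]_(v in T) (c ^+ k))%R.
  by rewrite Rintegral_cst// fineT [RHS]mulrCA -numEsg.
rewrite -mulrBr normrM normr_sg A0 mul1r -RintegralB//.
apply: (le_trans (le_normr_Rintegral _ _)) => //.
  by apply: (integrableB mT ipow (icst _)).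
apply: (@le_trans _ _ (\int[(mu \x mu)%E]_(v in T) (k%:R * M ^+ k.-1 * d))%R).
  apply: le_Rintegral => //.
    by have := integrable_norm (integrableB mT ipow (icst (c ^+ k))).
  move=> v vT; apply: pow_near; first exact: triangle_snd_bound vT.
  by have := @triangle_snd_bound p q r 0 M v; rewrite !subr0; apply.
by rewrite Rintegral_cst// fineT.
Qed.

End TriangleMeasure.

(** * Exactness of the Newton-Cotes quadratures *)

Section NewtonCotes.
Context {R : realType}.
Local Notation mu := (@lebesgue_measure R).
Implicit Types p q : {poly R}.

Definition poly_integral p : R := (\int[mu]_(u in `[0, 1]) p.[u])%R.

Lemma poly_integral_deriv p : poly_integral p^`() = p.[1] - p.[0].
Proof.
apply: (@Rintegral_derive R 0 1 _ (horner p)) => //.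
exact: continuous_horner.
Qed.

Lemma integrable_horner p : mu.-integrable `[0, 1] (EFin \o horner p).
Proof. exact: continuous_integrable_segment (@continuous_horner _ p). Qed.

Lemma poly_integralD p q :
  poly_integral (p + q) = poly_integral p + poly_integral q.
Proof.
rewrite /poly_integral -RintegralD//; [|exact: integrable_horner..].
by apply: eq_Rintegral => u _; rewrite hornerD.
Qed.

Lemma poly_integralZ (c : R) p : poly_integral (c *: p) = c * poly_integral p.
Proof.
rewrite /poly_integral -RintegralZl//; last exact: integrable_horner.
by apply: eq_Rintegral => u _; rewrite hornerZ.
Qed.

Lemma poly_integral_sum (I : Type) (s : seq I) (F : I -> {poly R}) :
  poly_integral (\sum_(i <- s) F i) = \sum_(i <- s) poly_integral (F i).
Proof.
elim: s => [|i s IH].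
  by rewrite !big_nil -(scale0r 0) poly_integralZ mul0r.
by rewrite !big_cons poly_integralD IH.
Qed.

Lemma poly_integral_odd p : (forall u, p.[1 - u] = - p.[u]) ->
  poly_integral p = 0.
Proof.
move=> podd.
have : poly_integral p = - poly_integral p.
  rewrite {1}/poly_integral Rintegration_by_substitution_onem ?ler01 ?lexx//.
    rewrite unstable.onem1 -mulN1r -poly_integralZ; apply: eq_Rintegral => u _.
    by rewrite hornerZ mulN1r -podd.
  by apply: continuous_subspaceT; exact: continuous_horner.
by lra.
Qed.

Section Interpolation.
Variable n : nat.
Hypothesis n_gt1 : (1 < n)%N.
Let N := n.-1.
Let node (j : nat) : R := j%:R / N%:R.

(** The Lagrange basis at [n] equally spaced nodes of [0, 1], written with linear factors in 'X so
    that its degree can be read off; its values are the integrands of [nc_weight]. *)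
Definition lagrange_poly (j : nat) : {poly R} :=
  \prod_(0 <= k < n | k != j)
    (((j%:R - k%:R)^-1 * n.-1%:R) *: ('X - (k%:R / n.-1%:R)%:P)).

Let N0 : N%:R != 0 :> R.
Proof. by rewrite pnatr_eq0 /N; case: n n_gt1 => [|[]]. Qed.

Lemma horner_lagrange_poly j u : (lagrange_poly j).[u] =
  \prod_(0 <= k < n | k != j) ((n.-1%:R * u - k%:R) / (j%:R - k%:R)).
Proof.
rewrite /lagrange_poly horner_prod; apply: eq_bigr => k kj.
rewrite !hornerE -/N [RHS]mulrC -mulrA; congr (_ * _).
by field.
Qed.

Lemma size_lagrange_poly j : (j < n)%N -> (size (lagrange_poly j) <= n)%N.
Proof.
move=> jn; rewrite /lagrange_poly scaler_prod.
apply: (leq_trans (size_scale_leq _ _)); rewrite -big_filter size_prod_XsubC.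
rewrite (_ : [seq _ <- _ | _] = rem j (index_iota 0 n)); last first.
  by rewrite rem_filter ?iota_uniq.
rewrite size_rem ?mem_index_iota// size_iota subn0.
by case: n n_gt1.
Qed.

Lemma lagrange_poly_node i j : (i < n)%N -> (j < n)%N ->
  (lagrange_poly j).[i%:R / n.-1%:R] = (i == j)%:R.
Proof.
move=> i_n jn; rewrite horner_lagrange_poly -/N mulrCA divff// mulr1.
have [->|ij] := eqVneq i j.
  by rewrite big1// => k kj; rewrite divff// subr_eq0 eqr_nat eq_sym.
rewrite big_mkcond (bigD1_seq i) ?iota_uniq ?mem_index_iota//=.
by rewrite ij subrr !mul0r.
Qed.

Lemma node_inj : injective node.
Proof.
move=> i j /(congr1 (fun z => z * N%:R)); rewrite /node !mulfVK//.
by move=> /eqP; rewrite eqr_nat => /eqP.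
Qed.

Lemma lagrange_interpolation p : (size p <= n)%N ->
  p = \sum_(0 <= j < n) p.[j%:R / n.-1%:R] *: lagrange_poly j.
Proof.
move=> sp; apply/eqP; rewrite -subr_eq0; apply/negPn/negP => d0.
set d := _ - _ in d0.
(* The difference has size at most [n] but vanishes at [n] distinct nodes. *)
have droot : all (root d) (map node (index_iota 0 n)).
  apply/allP => _ /mapP[i + ->]; rewrite mem_index_iota => /= i_n.
  rewrite rootE !hornerE horner_sum (bigD1_seq i) ?iota_uniq ?mem_index_iota//=.
  rewrite hornerZ lagrange_poly_node// eqxx mulr1 big_seq_cond big1.
    by rewrite addr0 subrr.
  move=> j; rewrite mem_index_iota => /= /andP[jn ji].
  by rewrite hornerZ lagrange_poly_node// eq_sym (negPf ji) mulr0.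
have := max_poly_roots d0 droot.
rewrite (map_inj_uniq node_inj) iota_uniq size_map size_iota subn0 => /(_ isT).
rewrite ltnNge => /negP; apply.
apply: (leq_trans (size_polyD _ _)); rewrite geq_max sp size_polyN.
apply: (leq_trans (size_sum _ _ _)); apply/bigmax_leqP_seq => j.
rewrite mem_index_iota => /= jn _; apply: (leq_trans (size_scale_leq _ _)).
exact: size_lagrange_poly.
Qed.

Lemma quadrature_interpolation p : (size p <= n)%N ->
  \sum_(0 <= j < n) poly_integral (lagrange_poly j) * p.[j%:R / n.-1%:R] =
  poly_integral p.
Proof.
move=> sp; rewrite [in RHS](lagrange_interpolation _ sp) poly_integral_sum.
by apply: eq_bigr => j _; rewrite poly_integralZ mulrC.
Qed.

(* The node polynomial is odd about 1/2, so that its integral vanishes: this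
   symmetry gains one degree of exactness. *)
Lemma quadrature_interpolation_odd p : odd n -> (size p <= n.+1)%N ->
  \sum_(0 <= j < n) poly_integral (lagrange_poly j) * p.[j%:R / n.-1%:R] =
  poly_integral p.
Proof.
move=> oddn sp.
pose Q := \prod_(0 <= j < n) ('X - (node j)%:P).
have sQ : size Q = n.+1 by rewrite size_prod_XsubC size_iota subn0.
have Qn : Q`_n = 1.
  by have := monic_prod_XsubC (index_iota 0 n) xpredT node;
    rewrite monicE lead_coefE -/Q sQ => /eqP.
(* The reflection about 1/2 permutes the nodes and changes the sign of each of the [n] factors, with
   [n] odd. *)
have Q_odd u : Q.[1 - u] = - Q.[u].
  rewrite !horner_prod big_nat_rev/=.
  transitivity (\prod_(0 <= j < n) (-1 * (u - node j))).
    apply: eq_big_nat => j /= jn; rewrite !hornerE.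
    rewrite /node (_ : (0 + n - j.+1)%N = (N - j)%N); last by rewrite /N; lia.
    by rewrite natrB; [field|rewrite /N; lia].
  rewrite big_split/= prodr_const_nat subn0 -signr_odd oddn expr1 mulN1r.
  by congr (- _); apply: eq_bigr => j _; rewrite !hornerE.
have Qnode j : (j < n)%N -> Q.[j%:R / N%:R] = 0.
  move=> jn; rewrite horner_prod (bigD1_seq j) ?iota_uniq ?mem_index_iota//=.
  by rewrite !hornerE subrr mul0r.
(* Both the quadrature and the integral vanish on [Q], which is monic of degree [n]: the top
   coefficient of [p] can be removed. *)
pose r := p - p`_n *: Q.
have sr : (size r <= n)%N.
  apply/leq_sizeP => i; rewrite leq_eqVlt => /predU1P[<-|ni].
    by rewrite coefB coefZ Qn mulr1 subrr.
  have Qi : Q`_i = 0 by rewrite nth_default ?sQ.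
  by rewrite coefB coefZ Qi mulr0 subr0 nth_default// (leq_trans sp).
have pE : p = r + p`_n *: Q by rewrite /r subrK.
rewrite [in RHS]pE poly_integralD poly_integralZ (poly_integral_odd _ Q_odd).
rewrite mulr0 addr0 -(quadrature_interpolation _ sr).
apply: eq_big_nat => j /= jn.
by rewrite [in LHS]pE hornerD hornerZ -/N Qnode// mulr0 addr0.
Qed.

End Interpolation.

(** For [m >= 2] there are 2m - 1 nodes, an odd number, and the extra degree from symmetry reaches
    2m - 1. The trapezoidal rule [m = 1] is checked directly. *)
Lemma dirac_integral_nu_poly (m : nat) p : (0 < m)%N -> (size p <= m.*2)%N ->
  dirac_integral (nu R m) (horner p) = poly_integral p.
Proof.
move=> m0 sp; rewrite /dirac_integral /nu; case: eqVneq => [m1|m1].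
  rewrite big_cons big_seq1/=.
  move: sp; rewrite m1 => sp.
  have pE : p = ((p`_0 *: 'X) + (p`_1 / 2) *: 'X^2)^`().
    rewrite derivD !derivZ derivX derivXn/=; apply/polyP => i.
    rewrite !(coefE, coefZ); case: i => [|[|i]]/=.
    - by rewrite mulr1 mul0rn mulr0 addr0.
    - by rewrite mulr0 add0r; field.
    - by rewrite nth_default ?(leq_trans sp)// mulr0 mul0rn mulr0 addr0.
  rewrite [in RHS]pE poly_integral_deriv.
  have pu u : p.[u] = p`_0 + p`_1 * u.
    rewrite {1}pE derivD !derivZ derivX derivXn/= !hornerE.
    by rewrite mulr2n; field.
  by rewrite !pu !hornerD !hornerZ !hornerX !hornerXn; field.
rewrite big_map.
have n1 : (1 < m.*2.-1)%N by lia.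
have NE : m.*2.-1.-1 = (m.*2 - 2)%N by lia.
have NR : (m.*2.-1.-1)%:R = 2 * (m%:R - 1) :> R.
  rewrite (_ : m.*2.-1.-1 = 2 * (m - 1))%N; last lia.
  by rewrite natrM natrB.
rewrite -(quadrature_interpolation_odd _ n1); last 2 first.
- by lia.
- by rewrite prednK//; lia.
rewrite NE /index_iota subn0; apply: eq_bigr => j _ /=; congr (_ * _).
apply: eq_Rintegral => u _; rewrite horner_lagrange_poly// NR.
by [].
Qed.

(** The integral is ((h + k)^(i+1) - h^(i+1)) / ((i+1) k); in factored form it needs no division by
    [k] and remains valid at [k = 0]. *)
Lemma dirac_integral_nu_pow (m i : nat) (h k : R) : (0 < m)%N -> (i < m.*2)%N ->
  dirac_integral (nu R m) (fun theta => (h + theta * k) ^+ i) =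
  i.+1%:R^-1 * \sum_(l < i.+1) (h + k) ^+ (i - l) * h ^+ l.
Proof.
move=> m0 im; pose p : {poly R} := (h%:P + k *: 'X) ^+ i.
transitivity (poly_integral p).
  rewrite -(dirac_integral_nu_poly m)//.
    apply: eq_bigr => a _; congr (_ * _).
    by rewrite /p horner_exp !hornerE [k * _]mulrC.
  apply: (leq_trans (size_poly_exp_leq _ _)); apply: leq_trans im.
  rewrite ltnS -[leqRHS]mul1n leq_mul2r; apply/orP; right.
  rewrite -subn1 leq_subLR; apply: (leq_trans (size_polyD _ _)).
  rewrite geq_max (leq_trans (size_polyC_leq1 _))//.
  by rewrite (leq_trans (size_scale_leq _ _))// size_polyX.
have i0 : i.+1%:R != 0 :> R by rewrite pnatr_eq0.
have [k0|k0] := eqVneq k 0.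
  have -> : p = (h ^+ i *: 'X)^`().
    by rewrite /p k0 scale0r addr0 -polyC_exp derivZ derivX alg_polyC.
  rewrite poly_integral_deriv !hornerZ !hornerX k0 addr0.
  rewrite (eq_bigr (fun=> h ^+ i)); last first.
    by move=> l _; rewrite -exprD subnK// -ltnS.
  by rewrite sumr_const card_ord -[in RHS]mulr_natl; field.
have -> : p = ((i.+1%:R * k)^-1 *: (h%:P + k *: 'X) ^+ i.+1)^`().
  rewrite derivZ deriv_exp/= derivD derivC add0r derivZ derivX alg_polyC -/p.
  by rewrite mul_polyC -[X in _ *: X]scaler_nat !scalerA mulVf ?scale1r//
    mulf_neq0.
rewrite poly_integral_deriv !hornerZ !horner_exp !hornerE -mulrBr subrXX.
rewrite [h + k - h]addrAC subrr add0r /=.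
by field; rewrite nat1r i0 k0.
Qed.

End NewtonCotes.

(** * Taylor expansions *)

Section Taylor.
Context {R : realType}.
Implicit Types f : R -> R.

Lemma derive1n_derive1 (i : nat) f : derive1n i (derive1 f) = derive1n i.+1 f.
Proof. by rewrite /derive1n iterSr. Qed.

Lemma derive1n_add (i j : nat) f :
  derive1n i (derive1n j f) = derive1n (i + j) f.
Proof. by rewrite /derive1n iterD. Qed.

Lemma derivable_continuous f x : derivable f x 1 -> {for x, continuous f}.
Proof. by move=> df; apply/differentiable_continuous/derivable1_diffP. Qed.

Lemma CclassW (k n : nat) f : (k <= n)%N -> Cclass n f -> Cclass k f.
Proof.
rewrite leq_eqVlt => /predU1P[->//|kn] [df cf]; split.
  by move=> i ik t; apply: df; exact: ltn_trans kn.
by move=> t; apply: derivable_continuous; exact: df.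
Qed.

Lemma Cclass_derive1n (k n i : nat) f : (k + i <= n)%N -> Cclass n f ->
  Cclass k (derive1n i f).
Proof.
move=> kin /(CclassW _ _ _ kin)[df cf]; split => [j jk t|].
  by rewrite derive1n_add; apply: df; rewrite ltn_add2r.
by rewrite derive1n_add.
Qed.

Lemma Cclass_continuous n f : Cclass n f -> continuous f.
Proof. by move=> /(CclassW _ _ _ (leq0n n))[]. Qed.

Definition taylor_poly (n : nat) f (a : R) : {poly R} :=
  \sum_(l < n) (derive1n l f a / l`!%:R) *: ('X - a%:P) ^+ l.

Lemma deriv_taylor_poly n f a :
  (taylor_poly n.+1 f a)^`() = taylor_poly n (derive1 f) a.
Proof.
rewrite /taylor_poly big_ord_recl derivD expr0 derivZ derivC scaler0 add0r.
rewrite raddf_sum; apply: eq_bigr => l _.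
rewrite -[LHS]/(_^`())%R derivZ deriv_exp derivXsubC mul1r derive1n_derive1/=.
rewrite /bump/= add1n.
rewrite -[X in _ *: X]scaler_nat scalerA factS natrM; congr (_ *: _).
by field; rewrite ?nat1r !pnatr_eq0 -?lt0n ?fact_gt0.
Qed.

Lemma horner_taylor_poly n f a b :
  (taylor_poly n f a).[b] =
  \sum_(l < n) derive1n l f a / l`!%:R * (b - a) ^+ l.
Proof.
rewrite horner_sum; apply: eq_bigr => l _.
by rewrite hornerZ horner_exp !hornerE.
Qed.

Lemma mean_value f (df : R -> R) (a b : R) :
  (forall z : R, is_derive z 1 f (df z)) ->
  exists c, [/\ `|c - a| <= `|b - a|, Num.min a b <= c <= Num.max a b &
    f b - f a = df c * (b - a)].
Proof.
move=> dfE.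
have cf : continuous f.
  by move=> x; apply: derivable_continuous; have [] := dfE x.
have [ab|ba|->] := ltgtP a b; last first.
- by exists b; split; rewrite ?subrr ?mulr0 ?lexx.
- have [c] := MVT ba (fun x _ => dfE x) (continuous_subspaceT cf).
  rewrite in_itv/= => /andP[bc ca] E; exists c; split; last by lra.
    by rewrite !ler0_norm ?subr_le0 ?(ltW ba) ?(ltW ca)//; lra.
  by rewrite (ltW bc) (ltW ca).
- have [c] := MVT ab (fun x _ => dfE x) (continuous_subspaceT cf).
  rewrite in_itv/= => /andP[ac cb] E; exists c; split; last by lra.
    by rewrite !ger0_norm ?subr_ge0 ?(ltW ab) ?(ltW ac)//; lra.
  by rewrite (ltW ac) (ltW cb).
Qed.

Lemma continuous_bounded f (M : R) : continuous f ->
  exists2 C, 0 <= C & forall a, `|a| <= M -> `|f a| <= C.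
Proof.
move=> cf; have [M0|M0] := ltP M 0.
  by exists 0 => // a aM; move: (le_lt_trans aM M0); rewrite normr_lt0.
have cn : continuous (fun u => `|f u|).
  by move=> u; apply: continuous_comp; [exact: cf|exact: norm_continuous].
have MM : - M <= M by lra.
have [c _ cmax] := EVT_max MM (continuous_subspaceT cn).
exists `|f c| => // a aM; apply: cmax; rewrite in_itv/=.
by rewrite ler_norml in aM.
Qed.

(** The remainder of [f] has as derivative the remainder of [f'] of one order less. The mean value
    theorem thus yields one factor [b - a] per step, at a point still in [-M, M], and the constant
    stays the bound of the n-th derivative on that interval. *)
Lemma taylor_bound n f (M : R) : Cclass n f ->
  exists2 C, 0 <= C & forall a b, `|a| <= M -> `|b| <= M ->
    `|f b - (taylor_poly n f a).[b]| <= C * `|b - a| ^+ n.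
Proof.
elim: n f => [|n IH] f Cf.
  have [C C0 fC] := continuous_bounded f M (Cclass_continuous _ _ Cf).
  exists C => // a b _ bM.
  by rewrite /taylor_poly big_ord0 horner0 subr0 expr0 mulr1 fC.
have Cf' : Cclass n (derive1 f).
  by apply: (@Cclass_derive1n n n.+1 1 f) => //; rewrite addn1.
have [C C0 HC] := IH _ Cf'.
exists C => // a b aM bM.
pose r z := f z - (taylor_poly n.+1 f a).[z].
have dr (z : R) : is_derive z 1 r
    (derive1 f z - (taylor_poly n (derive1 f) a).[z]).
  apply: is_deriveB; last by rewrite -deriv_taylor_poly; exact: is_derive_poly.
  by rewrite derive1E; apply: derivableP; exact: (Cf.1 0%N).
have ra : r a = 0.
  rewrite /r horner_taylor_poly big_ord_recl/= big1 => [|l _].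
    by rewrite expr0 mulr1 fact0 divr1 addr0 subrr.
  by rewrite subrr expr0n mulr0.
have [c [ca cab]] := mean_value _ _ a b dr.
rewrite ra subr0 -/(r b) => ->.
rewrite normrM exprSr mulrA ler_wpM2r//.
have cM : `|c| <= M.
  move: cab; rewrite ler_norml; move: aM bM; rewrite !ler_norml.
  move=> /andP[a1 a2] /andP[b1 b2] /andP[c1 c2]; apply/andP; split.
    by apply: le_trans c1; rewrite le_min a1 b1.
  by apply: (le_trans c2); rewrite ge_max a2 b2.
apply: (le_trans (HC a c aM cM)); rewrite ler_wpM2l// lerXn2r ?nnegrE//.
Qed.

End Taylor.

(** * Quadratures of Taylor expansions and increments *)

Section Quadrature.
Context {R : realType}.
Implicit Types f : R -> R.

Lemma nu_node (m : nat) (a : R * R) : a \in nu R m -> 0 <= a.2 <= 1.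
Proof.
rewrite /nu; case: eqP => [_|m1].
  by rewrite !inE => /orP[] /eqP ->; rewrite /= ?lexx ?ler01.
move=> /mapP[j]; rewrite mem_iota add0n => /= jm ->/=.
rewrite divr_ge0//=.
have [m0|m0] := posnP (m.*2 - 2); first by rewrite m0 invr0 mulr0 ler01.
rewrite ler_pdivrMr ?ltr0n// mul1r ler_nat.
by move: jm m0; case: (m.*2) => // -[|n]//=; rewrite subSS subn1.
Qed.

(* The mean over theta in [0, 1] of (p + theta (q - p))^i. *)
Definition segment_pow (i : nat) (p q : R) : R :=
  i.+1%:R^-1 * \sum_(l < i.+1) q ^+ (i - l) * p ^+ l.

(** The rule is exact on the Taylor polynomial since [n <= m.*2]; the remainder is bounded at each
    atom. The centre [z] need not be an end of the segment, so the three sides of a triangle can be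
    expanded at one point, and [n] is independent of [m], so rules of different orders can be
    compared. *)
Lemma quadrature_taylor (m n : nat) f (M : R) : (0 < m)%N -> (n <= m.*2)%N ->
  Cclass n f -> exists2 C, 0 <= C & forall z p q,
    `|z| <= M -> `|z + p| <= M -> `|z + q| <= M ->
    `|dirac_integral (nu R m)
        (fun theta => f ((1 - theta) * (z + p) + theta * (z + q))) -
      \sum_(i < n) derive1n i f z / i`!%:R * segment_pow i p q| <=
    C * (`|p| + `|q|) ^+ n.
Proof.
move=> m0 nm Cf; have [C C0 HC] := taylor_bound n f M Cf.
(* The total variation of the signed measure: Newton-Cotes weights may be negative. *)
pose W := \sum_(a <- nu R m) `|a.1|.
have W0 : 0 <= W by exact: sumr_ge0.
exists (W * C) => [|z p q zM pM qM]; first exact: mulr_ge0.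
pose b (theta : R) := (1 - theta) * (z + p) + theta * (z + q).
have -> : \sum_(i < n) derive1n i f z / i`!%:R * segment_pow i p q =
    dirac_integral (nu R m) (fun theta => (taylor_poly n f z).[b theta]).
  transitivity (\sum_(i < n) \sum_(a <- nu R m) a.1 *
      (derive1n i f z / i`!%:R * (b a.2 - z) ^+ i)).
    apply: eq_bigr => i _.
    have := @dirac_integral_nu_pow R m i p (q - p) m0 (leq_trans (ltn_ord i) nm).
    rewrite (_ : p + (q - p) = q); last by ring.
    rewrite -/(segment_pow i p q) => <-; rewrite /dirac_integral mulr_sumr.
    apply: eq_bigr => a _; rewrite mulrCA; congr (_ * (_ * _ ^+ _)).
    by rewrite /b; ring.
  rewrite exchange_big; apply: eq_bigr => a _ /=.
  by rewrite horner_taylor_poly -mulr_sumr.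
rewrite /dirac_integral -sumrB.
apply: (le_trans (ler_norm_sum _ _ _)).
rewrite /W -mulrA mulr_suml big_seq [leRHS]big_seq; apply: ler_sum => a /nu_node.
move=> /andP[a0 a1]; rewrite -mulrBr normrM ler_wpM2l//.
have a1' : 0 <= 1 - a.2 by rewrite subr_ge0.
have conv (v w B : R) : `|v| <= B -> `|w| <= B ->
    `|(1 - a.2) * v + a.2 * w| <= B.
  move=> vB wB; apply: (le_trans (ler_normD _ _)).
  rewrite !normrM (ger0_norm a0) (ger0_norm a1').
  have -> : B = (1 - a.2) * B + a.2 * B by ring.
  by rewrite lerD// ler_wpM2l.
apply: (le_trans (HC _ _ zM (conv _ _ _ pM qM))).
rewrite ler_wpM2l// lerXn2r ?nnegrE ?addr_ge0//.
have -> : b a.2 - z = (1 - a.2) * p + a.2 * q by rewrite /b; ring.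
by apply: conv; rewrite ?lerDl ?lerDr.
Qed.

(* For increments (a, h) and (b, g - h) of (x, y), the factor
   [b * h - a * (g - h)] is twice the signed area of the triangle. *)
Lemma segment_pow_cocycle (i : nat) (a b h g : R) :
  a * segment_pow i 0 h + b * segment_pow i h g - (a + b) * segment_pow i 0 g =
  (b * h - a * (g - h)) *
  (i.+1%:R^-1 * \sum_(l < i) g ^+ (i.-1 - l) * h ^+ l).
Proof.
have seg0 q : segment_pow i 0 q = i.+1%:R^-1 * q ^+ i.
  rewrite /segment_pow big_ord_recl big1 => [|l _].
    by rewrite subn0 expr0 mulr1 addr0.
  by rewrite expr0n mulr0.
have segh : segment_pow i h g = i.+1%:R^-1 *
    (g ^+ i + h * \sum_(l < i) g ^+ (i.-1 - l) * h ^+ l).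
  rewrite /segment_pow big_ord_recl subn0 expr0 mulr1; congr (_ * (_ + _)).
  rewrite mulr_sumr; apply: eq_bigr => l _ /=.
  by rewrite /bump/= add1n exprS subnS -subn1 subnAC subn1; ring.
have E := subrXX g h i.
rewrite !seg0 segh.
have -> : h ^+ i = g ^+ i - (g - h) * \sum_(l < i) g ^+ (i.-1 - l) * h ^+ l.
  by rewrite -E; ring.
by ring.
Qed.

End Quadrature.

(** * Calculus of error terms depending on two or three times *)

Section TripleO.
Context {R : realType}.
Implicit Types (e : R -> R -> R -> R) (w : R -> R -> R) (b c : R).

(** Every error is measured by the whole span [t - s]: exponents add under products, and bounded
    factors have exponent 0. The span is at most 1, so an exponent may be lowered. *)
Definition tripleO b e := exists2 C, 0 <= C &
  forall s u t, s < u -> u < t -> t <= s + 1 -> `|e s u t| <= C * (t - s) `^ b.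

(** The two times are not ordered, so the same bound also serves for reversed pairs. *)
Definition pairO b w := exists2 C, 0 <= C &
  forall s t, `|t - s| <= 1 -> `|w s t| <= C * `|t - s| `^ b.

Lemma tripleO_ext b e e' : (forall s u t, e s u t = e' s u t) ->
  tripleO b e -> tripleO b e'.
Proof. by move=> ee' [C C0 H]; exists C => // s u t; rewrite -ee'; exact: H. Qed.

Lemma tripleOD b e e' : tripleO b e -> tripleO b e' ->
  tripleO b (fun s u t => e s u t + e' s u t).
Proof.
move=> [C C0 H] [C' C'0 H']; exists (C + C') => [|s u t su ut st].
  exact: addr_ge0.
by apply: (le_trans (ler_normD _ _)); rewrite mulrDl lerD ?H ?H'.
Qed.

Lemma tripleON b e : tripleO b e -> tripleO b (fun s u t => - e s u t).
Proof. by move=> [C C0 H]; exists C => // s u t *; rewrite normrN; exact: H. Qed.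

Lemma tripleO_norm b e : tripleO b e -> tripleO b (fun s u t => `|e s u t|).
Proof.
move=> [C C0 H]; exists C => // s u t su ut st.
by rewrite normr_id; exact: H.
Qed.

Lemma tripleOB b e e' : tripleO b e -> tripleO b e' ->
  tripleO b (fun s u t => e s u t - e' s u t).
Proof. by move=> He He'; apply: tripleOD => //; exact: tripleON. Qed.

Lemma tripleOM b b' e e' : tripleO b e -> tripleO b' e' ->
  tripleO (b + b') (fun s u t => e s u t * e' s u t).
Proof.
move=> [C C0 H] [C' C'0 H']; exists (C * C') => [|s u t su ut st].
  exact: mulr_ge0.
have ts : 0 < t - s by rewrite subr_gt0; exact: lt_trans ut.
rewrite normrM powRD; last by rewrite (gt_eqF ts) implybT.
by rewrite mulrACA ler_pM ?H ?H'.
Qed.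

Lemma tripleOW b b' e : b' <= b -> tripleO b e -> tripleO b' e.
Proof.
move=> bb [C C0 H]; exists C => // s u t su ut st.
apply: (le_trans (H _ _ _ su ut st)); rewrite ler_wpM2l//.
have ts : 0 < t - s by rewrite subr_gt0; exact: lt_trans ut.
by apply: ger_powR => //; rewrite ts/= lerBlDl.
Qed.

Lemma tripleO_le b e e' (K : R) : 0 <= K ->
  (forall s u t, s < u -> u < t -> t <= s + 1 -> `|e s u t| <= K * `|e' s u t|) ->
  tripleO b e' -> tripleO b e.
Proof.
move=> K0 ee' [C C0 H]; exists (K * C) => [|s u t su ut st].
  exact: mulr_ge0.
by apply: (le_trans (ee' _ _ _ su ut st)); rewrite -mulrA ler_wpM2l ?H.
Qed.

Lemma tripleO_bounded e (K : R) : (forall s u t, `|e s u t| <= K) -> tripleO 0 e.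
Proof.
move=> eK; exists K => [|s u t _ _ _]; last by rewrite powRr0 mulr1.
by exact: le_trans (eK 0 0 0).
Qed.

Lemma tripleO0 b : tripleO b (fun _ _ _ => 0).
Proof. by exists 0 => // s u t _ _ _; rewrite normr0 mul0r. Qed.

Lemma tripleO_sum b (I : Type) (r : seq I) (P : pred I)
    (e : I -> R -> R -> R -> R) :
  (forall i, P i -> tripleO b (e i)) ->
  tripleO b (fun s u t => \sum_(i <- r | P i) e i s u t).
Proof.
move=> He; elim: r => [|i r IH].
  by apply: tripleO_ext (tripleO0 b) => s u t; rewrite big_nil.
have [Pi|nPi] := boolP (P i).
  by apply: tripleO_ext (tripleOD _ _ _ (He _ Pi) IH) => s u t; rewrite big_cons Pi.
by apply: tripleO_ext IH => s u t; rewrite big_cons (negPf nPi).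
Qed.

Lemma tripleOX b e (n : nat) : tripleO b e ->
  tripleO (n%:R * b) (fun s u t => e s u t ^+ n).
Proof.
move=> He; elim: n => [|n IH].
  rewrite mul0r; apply: (@tripleO_bounded _ 1) => s u t.
  by rewrite expr0 normr1.
rewrite -natr1 mulrDl mul1r.
by apply: tripleO_ext (tripleOM _ _ _ _ IH He) => s u t; rewrite exprSr.
Qed.

Lemma pairO_triple b w : 0 <= b -> pairO b w ->
  [/\ tripleO b (fun s u t => w s u), tripleO b (fun s u t => w u t),
      tripleO b (fun s u t => w s t) & tripleO b (fun s u t => w t s)].
Proof.
move=> b0 [C C0 H].
have key (v v' s t : R) : `|v' - v| <= t - s -> t <= s + 1 ->
    `|w v v'| <= C * (t - s) `^ b.
  move=> vv ts; have v1 : `|v' - v| <= 1 by apply: (le_trans vv); lra.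
  apply: (le_trans (H _ _ v1)); rewrite ler_wpM2l// ge0_ler_powR ?nnegrE//.
  exact: le_trans vv.
by split; exists C => // s u t su ut ts; apply: key => //; rewrite ler_norml;
  apply/andP; split; lra.
Qed.

Lemma pairO_sum b n (w : 'I_n -> R -> R -> R) :
  (forall i, pairO b (w i)) -> pairO b (fun s t => \sum_(i < n) w i s t).
Proof.
elim: n w => [|n IH] w wO.
  by exists 0 => // s t _; rewrite big_ord0 normr0 mul0r.
have [C C0 H] := IH _ (fun i => wO (lift ord0 i)).
have [C' C'0 H'] := wO ord0.
exists (C' + C) => [|s t st]; first exact: addr_ge0.
rewrite big_ord_recl mulrDl; apply: (le_trans (ler_normD _ _)).
by rewrite lerD ?H ?H'.
Qed.

Lemma pairO_W b b' w : b' <= b -> 0 < b' -> pairO b w -> pairO b' w.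
Proof.
move=> bb b'0 [C C0 H]; exists C => // s t st1.
apply: (le_trans (H _ _ st1)); rewrite ler_wpM2l//.
have [->|st0] := eqVneq `|t - s| 0; first by rewrite !powR0// gt_eqF//; lra.
by apply: ger_powR => //; rewrite lt_neqAle eq_sym st0 normr_ge0.
Qed.

End TripleO.

(** * The germ of a corrected functional *)

Lemma continuous_sum {R : realType} (I : Type) (r : seq I) (F : I -> R -> R) :
  (forall i, continuous (F i)) -> continuous (fun u => \sum_(i <- r) F i u).
Proof.
move=> cF; elim: r => [|i r IH].
  have -> : (fun u => \sum_(j <- [::]) F j u) = (fun=> 0).
    by apply/funext => v; rewrite big_nil.
  by move=> u; exact: cvg_cst.
have -> : (fun u => \sum_(j <- i :: r) F j u) =
    (fun u => F i u + \sum_(j <- r) F j u).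
  by apply/funext => v; rewrite big_cons.
by move=> u; apply: cvgD; [exact: cF|exact: IH].
Qed.

Section LevyArea.
Context {R : realType} (m : nat) (alpha M : R) (x y : R -> R)
  (A : R -> R -> {poly R} -> R).
Hypothesis m_gt0 : (0 < m)%N.
Hypothesis alpha_gt0 : 0 < alpha.
Hypothesis x_holder : pairO alpha (fun s t => x t - x s).
Hypothesis y_holder : pairO alpha (fun s t => y t - y s).
Hypothesis x_le : forall t, `|x t| <= M.
Hypothesis y_le : forall t, `|y t| <= M.
Hypothesis A_linear : forall s t c (p q : {poly R}),
  (size p <= m.*2.-1)%N -> (size q <= m.*2.-1)%N ->
  A s t (c *: p + q) = c * A s t p + A s t q.
Hypothesis A_chain : forall r s t k, (k <= m.*2 - 2)%N ->
  A r s 'X^k + A s t 'X^k + A t r 'X^k =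
  - signed_moment (x r, y r) (x s, y s) (x t, y t) k.
Hypothesis A_le : exists2 C, 0 <= C & forall s t k, (k <= m.*2 - 2)%N ->
  forall zeta, Num.min (y s) (y t) <= zeta <= Num.max (y s) (y t) ->
  `|A s t (('X - zeta%:P) ^+ k)| <= C * `|t - s| `^ (m.*2%:R * alpha).

Local Notation beta := (m.*2%:R * alpha).
Local Notation area s u t := (signed_area (x s, y s) (x u, y u) (x t, y t)).
Local Notation moment s u t k :=
  (signed_moment (x s, y s) (x u, y u) (x t, y t) k).

Lemma M_ge0 : 0 <= M. Proof. exact: le_trans (y_le 0). Qed.

Lemma beta_ge : alpha <= beta.
Proof. by rewrite ler_peMl// ?(ltW alpha_gt0)// ler1n; lia. Qed.

Lemma beta_gt0 : 0 < beta. Proof. exact: lt_le_trans beta_ge. Qed.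

Lemma A_zero s t : A s t 0 = 0.
Proof.
have := A_linear s t 1 0 0; rewrite size_poly0 scale1r addr0 mul1r => /(_ _ _)H.
have : A s t 0 = A s t 0 + A s t 0 by apply: H.
by lra.
Qed.

Lemma A_sum s t n (c : 'I_n -> R) (P : 'I_n -> {poly R}) :
  (forall i, (size (P i) <= m.*2.-1)%N) ->
  A s t (\sum_(i < n) c i *: P i) = \sum_(i < n) c i * A s t (P i).
Proof.
elim: n c P => [|n IH] c P sP; first by rewrite !big_ord0 A_zero.
rewrite !big_ord_recl A_linear ?IH//.
apply: (leq_trans (size_sum _ _ _)); apply/bigmax_leqP => i _.
exact: leq_trans (size_scale_leq _ _) (sP _).
Qed.

(** Chain relations are stated for powers centred at 0 and size bounds for powers centred on the
    segment; this change of centre links the two. *)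
Lemma A_binomial s t (c d : R) k : (k <= m.*2 - 2)%N ->
  A s t (('X - c%:P) ^+ k) =
  \sum_(i < k.+1) ((d - c) ^+ i *+ 'C(k, i)) * A s t (('X - d%:P) ^+ (k - i)).
Proof.
move=> km; rewrite -A_sum => [|i]; last first.
  by rewrite size_exp_XsubC; lia.
congr (A s t _).
have -> : 'X - c%:P = ('X - d%:P) + (d - c)%:P by rewrite polyCB; ring.
rewrite exprDn; apply: eq_bigr => i _.
by rewrite -polyC_exp mulrC mul_polyC -scaler_nat scalerA mulr_natl.
Qed.

Lemma A_same s k : (k <= m.*2 - 2)%N -> A s s 'X^k = 0.
Proof.
move=> km; have := A_chain s s s _ km.
rewrite /signed_moment (_ : area s s s = 0) ?sgr0 ?mul0r; last first.
  by rewrite /signed_area /=; ring.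
by lra.
Qed.

Lemma A_antisym s t k : (k <= m.*2 - 2)%N -> A t s 'X^k = - A s t 'X^k.
Proof.
move=> km; have := A_chain s s t _ km.
rewrite /signed_moment (_ : area s s t = 0) ?sgr0 ?mul0r; last first.
  by rewrite /signed_area /=; ring.
by rewrite A_same//; lra.
Qed.

Lemma A_defect s u t k : (k <= m.*2 - 2)%N ->
  A s u 'X^k + A u t 'X^k - A s t 'X^k = - moment s u t k.
Proof. by move=> km; rewrite -A_chain// (A_antisym s t _ km). Qed.

Lemma A_pow_O k : (k <= m.*2 - 2)%N ->
  pairO beta (fun s t => A s t (('X - (y s)%:P) ^+ k)).
Proof.
move=> km; have [C C0 H] := A_le; exists C => // s t _; apply: H => //.
by rewrite ge_min le_max lexx.
Qed.

Lemma A_monomial_O k : (k <= m.*2 - 2)%N -> pairO beta (fun s t => A s t 'X^k).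
Proof.
move=> km; have [C C0 H] := A_le.
exists (\sum_(i < k.+1) (M ^+ i *+ 'C(k, i)) * C) => [|s t _].
  apply: sumr_ge0 => i _; rewrite mulr_ge0// mulrn_wge0// exprn_ge0//.
  exact: M_ge0.
have -> : 'X^k = ('X - 0%:P) ^+ k :> {poly R} by rewrite subr0.
rewrite (A_binomial _ _ _ (y s) _ km) mulr_suml.
apply: (le_trans (ler_norm_sum _ _ _)); apply: ler_sum => i _.
rewrite normrM -mulrA ler_pM//.
  rewrite normrMn normrX subr0 lerMn2r; apply/orP; right.
  by apply: lerXn2r; rewrite ?nnegrE ?M_ge0.
apply: H; first lia.
by rewrite ge_min le_max lexx.
Qed.

Lemma moment0 s u t : moment s u t 0 = area s u t.
Proof.
have d0 v : `|y v - 0| <= M by rewrite subr0.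
have := @signed_moment_near R (x s, y s) (x u, y u) (x t, y t) 0 0 M M.
rewrite normr0 M_ge0 !mul0r expr0 mul1r /= => /(_ isT) H.
by apply/eqP; rewrite -subr_eq0 -normr_le0; exact: H.
Qed.

Lemma y_triple : [/\ tripleO alpha (fun s u t => y u - y s),
    tripleO alpha (fun s u t => y t - y u),
    tripleO alpha (fun s u t => y t - y s) &
    tripleO alpha (fun s u t => y s - y t)].
Proof. exact: pairO_triple (ltW alpha_gt0) y_holder. Qed.

Lemma x_triple : [/\ tripleO alpha (fun s u t => x u - x s),
    tripleO alpha (fun s u t => x t - x u),
    tripleO alpha (fun s u t => x t - x s) &
    tripleO alpha (fun s u t => x s - x t)].
Proof. exact: pairO_triple (ltW alpha_gt0) x_holder. Qed.

(* The bound on [A 1] forces all triangles inscribed in the path to be small: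
   this is why the Taylor coefficients in front of [A] only matter for k = 0. *)
Lemma area_O : tripleO beta (fun s u t => area s u t).
Proof.
have [H1 H2 H3 _] := pairO_triple _ _ (ltW beta_gt0) (A_monomial_O _ (leq0n _)).
apply: tripleO_ext (tripleON _ _ (tripleOB _ _ _ (tripleOD _ _ _ H1 H2) H3)).
by move=> s u t; rewrite A_defect// moment0 opprK.
Qed.

Lemma moment_near_O k : (k <= m.*2 - 2)%N ->
  tripleO (beta + alpha) (fun s u t => moment s u t k - y s ^+ k * area s u t).
Proof.
move=> km; have [H1 _ H2 _] := y_triple.
pose d s u t := `|y u - y s| + `|y t - y s|.
have dO : tripleO alpha d.
  by apply: tripleOD; apply: tripleO_norm.
apply: (@tripleO_le _ _ _ _ (k%:R * M ^+ k.-1)); last first.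
- exact: tripleOM area_O dO.
- move=> s u t _ _ _; rewrite normrM [leRHS]mulrCA [leRHS]mulrC.
  rewrite [`|d s u t|]ger0_norm; last by rewrite addr_ge0.
  by apply: signed_moment_near => //=; rewrite ?subrr ?normr0 /d ?addr_ge0//;
    rewrite ?lerDl ?lerDr.
- by rewrite mulr_ge0// exprn_ge0// M_ge0.
Qed.

(** Expanding around 0 turns the defect into moments of order [k - i], each close to
    [y s ^+ (k - i)] times the area. By the binomial formula their combination has coefficient
    [(y s - y s) ^+ k], which is 0 unless [k = 0]. *)
Lemma A_pow_defect_O k : (k <= m.*2 - 2)%N ->
  tripleO (beta + alpha) (fun s u t =>
    A s u (('X - (y s)%:P) ^+ k) + A u t (('X - (y s)%:P) ^+ k) -
    A s t (('X - (y s)%:P) ^+ k) + (k == 0%N)%:R * area s u t).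
Proof.
move=> km.
apply: (@tripleO_ext _ _ (fun s u t => \sum_(i < k.+1)
  - (((0 - y s) ^+ i *+ 'C(k, i)) *
   (moment s u t (k - i) - y s ^+ (k - i) * area s u t)))) => [s u t|].
  rewrite !(A_binomial _ _ (y s) 0 _ km) -big_split -sumrB /=.
  have -> : (k == 0%N)%:R = \sum_(i < k.+1)
      (y s ^+ (k - i) * (0 - y s) ^+ i) *+ 'C(k, i).
    by rewrite -exprDn sub0r subrr expr0n.
  rewrite mulr_suml -big_split; apply: eq_bigr => i _ /=.
  rewrite subr0 -mulrDr -mulrBr A_defect; last lia.
  by rewrite -mulr_natl -[in RHS]mulr_natl; ring.
apply: tripleO_sum => i _; apply: tripleON.
rewrite -[beta + alpha]add0r; apply: tripleOM; last by apply: moment_near_O; lia.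
apply: (@tripleO_bounded _ _ (M ^+ i *+ 'C(k, i))) => s _ _.
rewrite normrMn normrX sub0r normrN lerMn2r; apply/orP; right.
by apply: lerXn2r; rewrite ?nnegrE ?M_ge0.
Qed.

(** Once the leading term of the change of centre cancels, every remaining term contains the factor
    [y u - y s], hence the gain of [alpha]. *)
Lemma A_pow_basepoint_O k : (k <= m.*2 - 2)%N ->
  tripleO (beta + alpha) (fun s u t =>
    A u t (('X - (y u)%:P) ^+ k) - A u t (('X - (y s)%:P) ^+ k)).
Proof.
move=> km; have [yO _ _ _] := y_triple.
apply: (@tripleO_ext _ _ (fun s u t => - \sum_(i < k)
  (((y u - y s) * (y u - y s) ^+ i) *+ 'C(k, i.+1)) *
     A u t (('X - (y u)%:P) ^+ (k - i.+1)))) => [s u t|].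
  rewrite [X in _ = _ - X](A_binomial _ _ _ (y u) _ km) big_ord_recl.
  rewrite expr0 bin0 mulr1n mul1r subn0 opprD addrA subrr add0r.
  by congr (- _); apply: eq_bigr => i _; rewrite /= /bump/= add1n exprS.
apply: tripleON; apply: tripleO_sum => i _.
rewrite addrC; apply: tripleOM; last first.
  have ik : (k - i.+1 <= m.*2 - 2)%N by lia.
  by have [_ + _ _] := pairO_triple _ _ (ltW beta_gt0) (A_pow_O _ ik).
apply: (@tripleO_le _ _ _ _ ((M + M) ^+ i *+ 'C(k, i.+1))) yO => [|s u t _ _ _].
  by rewrite mulrn_wge0// exprn_ge0// addr_ge0// M_ge0.
rewrite normrMn normrM -mulrnAr [leRHS]mulrC ler_wpM2l//.
rewrite lerMn2r; apply/orP; right; rewrite normrX.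
apply: lerXn2r; rewrite ?nnegrE ?addr_ge0 ?M_ge0//.
by apply: (le_trans (ler_normB _ _)); rewrite lerD.
Qed.

(** With all three sides expanded at [y s], the term of degree [i] is twice the area times a
    coefficient: 0 for i = 0, half of [f'] for i = 1, and O(|t - s|^alpha) for i >= 2. Taylor
    remainders of order 2m gain [alpha] from the increment of [x] that multiplies them. *)
Lemma quadrature_defect_O f : Cclass m.*2 f ->
  tripleO (beta + alpha) (fun s u t =>
    (x u - x s) * dirac_integral (nu R m)
      (fun theta => f ((1 - theta) * y s + theta * y u)) +
    (x t - x u) * dirac_integral (nu R m)
      (fun theta => f ((1 - theta) * y u + theta * y t)) -
    (x t - x s) * dirac_integral (nu R m)
      (fun theta => f ((1 - theta) * y s + theta * y t)) -
    derive1n 1 f (y s) * area s u t).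
Proof.
move=> Cf.
pose Q (v w : R) := dirac_integral (nu R m)
  (fun theta => f ((1 - theta) * v + theta * w)).
pose c i z := derive1n i f z / i`!%:R.
pose T z p q := \sum_(i < m.*2) c i z * segment_pow i p q.
have [C C0 HC] := quadrature_taylor m _ _ M m_gt0 (leqnn _) Cf.
have rem (v w : R -> R -> R -> R) :
    tripleO alpha (fun s u t => v s u t - y s) ->
    tripleO alpha (fun s u t => w s u t - y s) ->
    (forall s u t, `|v s u t| <= M) -> (forall s u t, `|w s u t| <= M) ->
    tripleO beta (fun s u t => Q (v s u t) (w s u t) -
      T (y s) (v s u t - y s) (w s u t - y s)).
  move=> vO wO vM wM.
  have vwO := tripleOX _ _ m.*2
    (tripleOD _ _ _ (tripleO_norm _ _ vO) (tripleO_norm _ _ wO)).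
  apply: tripleO_le vwO => [|s u t _ _ _]; first exact: C0.
  have := HC (y s) (v s u t - y s) (w s u t - y s) (y_le s).
  rewrite !(addrC (y s)) !subrK => /(_ (vM _ _ _) (wM _ _ _)).
  by rewrite [`|_ ^+ _|]ger0_norm// exprn_ge0// addr_ge0.
have [h1 h2 h3 _] := y_triple.
have [a1 a2 a3 _] := x_triple.
have yy : tripleO alpha (fun s u t : R => y s - y s).
  by apply: tripleO_ext (tripleO0 alpha) => s u t; rewrite subrr.
have yl1 (s u t : R) := y_le s.
have yl2 (s u t : R) := y_le u.
have yl3 (s u t : R) := y_le t.
have r1 := tripleOM _ _ _ _ (rem _ _ yy h1 yl1 yl2) a1.
have r2 := tripleOM _ _ _ _ (rem _ _ h1 h3 yl2 yl3) a2.
have r3 := tripleOM _ _ _ _ (rem _ _ yy h3 yl1 yl3) a3.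
have [n mn] : exists n, m.*2 = n.+2 by exists (m.*2 - 2)%N; lia.
pose V i s u t := i.+1%:R^-1 *
  \sum_(l < i) (y t - y s) ^+ (i.-1 - l) * (y u - y s) ^+ l.
(* Each summand has total degree i + 1 >= 1 in the increments of [y]; one increment is kept for the
   exponent (that of [y t] if l = 0, of [y u] otherwise) and the others are merely bounded. *)
have VO i : tripleO alpha (V i.+2).
  rewrite -[alpha]add0r; apply: tripleOM.
    exact: (@tripleO_bounded _ _ `|i.+3%:R^-1|).
  apply: tripleO_sum => l _.
  have MM : 0 <= M + M by rewrite addr_ge0// M_ge0.
  have dy s t : `|y t - y s| <= M + M.
    by apply: (le_trans (ler_normB _ _)); rewrite lerD.
  have bu j : tripleO 0 (fun s u t => (y u - y s) ^+ j).
    apply: (@tripleO_bounded _ _ ((M + M) ^+ j)) => s u t.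
    by rewrite normrX; apply: lerXn2r; rewrite ?nnegrE.
  have bt j : tripleO 0 (fun s u t => (y t - y s) ^+ j).
    apply: (@tripleO_bounded _ _ ((M + M) ^+ j)) => s u t.
    by rewrite normrX; apply: lerXn2r; rewrite ?nnegrE.
  have [l0|l0] := posnP l.
    have il : (i.+2.-1 - l)%N = i.+1 by rewrite l0 subn0.
    rewrite -[alpha]addr0; apply: tripleOM; last first.
      exact: bu.
    rewrite il; rewrite -[alpha]addr0.
    apply: (@tripleO_ext _ _ (fun s u t => (y t - y s) * (y t - y s) ^+ i)).
      by move=> s u t; rewrite exprS.
    by apply: tripleOM => //; exact: bt.
  have lE : nat_of_ord l = l.-1.+1 by rewrite prednK.
  rewrite -[alpha]add0r; apply: tripleOM.
    exact: bt.
  rewrite lE; rewrite -[alpha]addr0.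
  apply: (@tripleO_ext _ _ (fun s u t => (y u - y s) * (y u - y s) ^+ l.-1)).
    by move=> s u t; rewrite exprS.
  by apply: tripleOM => //; exact: bu.
have cO i : (i < m.*2)%N -> tripleO 0 (fun s _ _ => c i (y s)).
  move=> im.
  have Ci : continuous (derive1n i f).
    by apply: (@Cclass_continuous _ 0); apply: Cclass_derive1n Cf; lia.
  have [K K0 cK] := continuous_bounded _ M Ci.
  apply: (@tripleO_bounded _ _ (K * `|i`!%:R^-1|)) => s u t.
  by rewrite normrM ler_wpM2r// cK.
have main : tripleO (beta + alpha) (fun s u t =>
    \sum_(i < n) area s u t * (2 * c i.+2 (y s) * V i.+2 s u t)).
  apply: tripleO_sum => i _; apply: tripleOM; first exact: area_O.
  rewrite -[alpha]add0r; apply: tripleOM; last exact: VO.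
  rewrite -[0]addr0; apply: tripleOM; first exact: (@tripleO_bounded _ _ `|2|).
  by apply: cO; rewrite mn ltnS ltnS.
have := tripleOD _ _ _ main (tripleOB _ _ _ (tripleOD _ _ _ r1 r2) r3).
apply: tripleO_ext => s u t; rewrite -/(Q _ _) -/(Q _ _) -/(Q _ _).
have TE : (x u - x s) * T (y s) (y s - y s) (y u - y s) +
    (x t - x u) * T (y s) (y u - y s) (y t - y s) -
    (x t - x s) * T (y s) (y s - y s) (y t - y s) =
    derive1n 1 f (y s) * area s u t +
    \sum_(i < n) area s u t * (2 * c i.+2 (y s) * V i.+2 s u t).
  rewrite /T subrr !mulr_sumr -big_split -sumrB /=.
  have areaE : 2 * area s u t = (x t - x u) * (y u - y s) -
      (x u - x s) * (y t - y s - (y u - y s)).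
    by rewrite /signed_area /=; field.
  transitivity (\sum_(i < m.*2) 2 * area s u t * (c i (y s) * V i s u t)).
    apply: eq_bigr => i _; rewrite areaE /V.
    have := segment_pow_cocycle i (x u - x s) (x t - x u) (y u - y s) (y t - y s).
    rewrite (_ : x u - x s + (x t - x u) = x t - x s); last by ring.
    move=> E; transitivity (c i (y s) *
      ((x u - x s) * segment_pow i 0 (y u - y s) +
       (x t - x u) * segment_pow i (y u - y s) (y t - y s) -
       (x t - x s) * segment_pow i 0 (y t - y s))); first by ring.
    by rewrite E; ring.
  rewrite mn !big_ord_recl /= /V big_ord0 mulr0 !mulr0 add0r.
  rewrite big_ord_recl big_ord0 !expr0 /c /= /bump /= !add1n.
  congr (_ + _); first by rewrite (_ : 1`! = 1%N)//; field.
  by apply: eq_bigr => i _; rewrite !add1n !add0n; ring.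
rewrite -[derive1n 1 f (y s) * _](@addrK _ (\sum_(i < n) area s u t *
  (2 * c i.+2 (y s) * V i.+2 s u t))) -TE.
by ring.
Qed.

(** Three errors: the defect of the area at the fixed centre [y s], the change of the coefficient,
    and the change of centre. Since k + 1 <= 2m - 1, the coefficient is still of class C^1, hence
    Lipschitz on [-M, M]. *)
Lemma levy_term_defect_O f k : (k <= m.*2 - 2)%N -> Cclass m.*2 f ->
  tripleO (beta + alpha) (fun s u t =>
    derive1n k.+1 f (y s) * A s u (('X - (y s)%:P) ^+ k) +
    derive1n k.+1 f (y u) * A u t (('X - (y u)%:P) ^+ k) -
    derive1n k.+1 f (y s) * A s t (('X - (y s)%:P) ^+ k) +
    (k == 0%N)%:R * (derive1n k.+1 f (y s) * area s u t)).
Proof.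
move=> km Cf.
have Ck : Cclass 1 (derive1n k.+1 f) by apply: Cclass_derive1n Cf; lia.
have [K K0 cK] := continuous_bounded _ M (Cclass_continuous _ _ Ck).
have [L L0 cL] := taylor_bound _ _ M Ck.
have cO : tripleO 0 (fun s _ _ => derive1n k.+1 f (y s)).
  by apply: (@tripleO_bounded _ _ K) => s _ _; exact: cK.
have [h1 _ _ _] := y_triple.
have dcO : tripleO alpha (fun s u _ =>
    derive1n k.+1 f (y u) - derive1n k.+1 f (y s)).
  apply: tripleO_le h1 => [|s u t _ _ _]; first exact: L0.
  have := cL (y s) (y u) (y_le s) (y_le u).
  by rewrite horner_taylor_poly big_ord1 expr0 mulr1 fact0 divr1 expr1.
have [_ AO _ _] := pairO_triple _ _ (ltW beta_gt0) (A_pow_O _ km).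
have t1 := tripleOM _ _ _ _ cO (A_pow_defect_O _ km).
have t2 := tripleOM _ _ _ _ AO dcO.
have t3 := tripleOM _ _ _ _ cO (A_pow_basepoint_O _ km).
rewrite !add0r in t1 t3.
apply: tripleO_ext (tripleOD _ _ _ (tripleOD _ _ _ t1 t2) t3) => s u t.
by rewrite /=; ring.
Qed.

Definition germ f (s t : R) : R :=
  (x t - x s) * dirac_integral (nu R m)
    (fun theta => f ((1 - theta) * y s + theta * y t)) +
  \sum_(k < m.*2.-1) (k.+1`!%:R)^-1 *
    (derive1n k.+1 f (y s) * A s t (('X - (y s)%:P) ^+ k)).

Lemma germ_defect_O f : Cclass m.*2 f ->
  tripleO (beta + alpha) (fun s u t => germ f s u + germ f u t - germ f s t).
Proof.
move=> Cf; have [n mn] : exists n, m.*2.-1 = n.+1.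
  by exists (m.*2 - 2)%N; lia.
have tO : tripleO (beta + alpha) (fun s u t => \sum_(k < m.*2.-1)
    (k.+1`!%:R)^-1 * (
    derive1n k.+1 f (y s) * A s u (('X - (y s)%:P) ^+ k) +
    derive1n k.+1 f (y u) * A u t (('X - (y u)%:P) ^+ k) -
    derive1n k.+1 f (y s) * A s t (('X - (y s)%:P) ^+ k) +
    (k == 0%N :> nat)%:R * (derive1n k.+1 f (y s) * area s u t))).
  apply: tripleO_sum => k _; rewrite -[beta + alpha]add0r; apply: tripleOM.
    exact: (@tripleO_bounded _ _ `|k.+1`!%:R^-1|).
  by apply: levy_term_defect_O => //; have := ltn_ord k; lia.
apply: tripleO_ext (tripleOD _ _ _ (quadrature_defect_O _ Cf) tO) => s u t.
rewrite /germ.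
under eq_bigr do rewrite mulrDr mulrBr mulrDr.
rewrite big_split sumrB big_split /=.
have -> : \sum_(k < m.*2.-1) k.+1`!%:R^-1 * ((k == 0%N :> nat)%:R *
    (derive1n k.+1 f (y s) * area s u t)) = derive1n 1 f (y s) * area s u t.
  rewrite mn big_ord_recl big1 => [|k _]; first by rewrite /= invr1 !mul1r addr0.
  by rewrite /= mul0r mulr0.
by rewrite derive1n1; ring.
Qed.

Lemma dirac_integral_bounded f : continuous f ->
  exists2 C, 0 <= C & forall s t,
    `|dirac_integral (nu R m) (fun theta => f ((1 - theta) * y s + theta * y t))|
    <= C.
Proof.
move=> cf; have [K K0 fK] := continuous_bounded f M cf.
exists (\sum_(a <- nu R m) `|a.1| * K) => [|s t].
  by apply: sumr_ge0 => a _; exact: mulr_ge0.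
apply: (le_trans (ler_norm_sum _ _ _)).
rewrite big_seq [leRHS]big_seq; apply: ler_sum => a /nu_node /andP[a0 a1].
rewrite normrM ler_wpM2l// fK//; apply: (le_trans (ler_normD _ _)).
rewrite !normrM (ger0_norm a0) ger0_norm ?subr_ge0//.
have -> : M = (1 - a.2) * M + a.2 * M by ring.
by rewrite lerD// ler_wpM2l// subr_ge0.
Qed.

Lemma levy_term_O f k : (k <= m.*2 - 2)%N -> Cclass m.*2 f ->
  pairO beta (fun s t =>
    derive1n k.+1 f (y s) * A s t (('X - (y s)%:P) ^+ k)).
Proof.
move=> km Cf.
have Ck : Cclass 0 (derive1n k.+1 f) by apply: Cclass_derive1n Cf; lia.
have [K K0 cK] := continuous_bounded _ M (Cclass_continuous _ _ Ck).
have [C C0 H] := A_pow_O _ km.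
exists (K * C) => [|s t st]; first exact: mulr_ge0.
by rewrite normrM -mulrA ler_pM// ?cK ?H.
Qed.

Lemma germ_O f : Cclass m.*2 f -> pairO alpha (germ f).
Proof.
move=> Cf; have [K K0 fK] := dirac_integral_bounded _ (Cclass_continuous _ _ Cf).
have [L L0 xL] := x_holder.
have termO k : (k <= m.*2 - 2)%N -> pairO alpha (fun s t =>
    derive1n k.+1 f (y s) * A s t (('X - (y s)%:P) ^+ k)).
  by move=> km; apply: pairO_W (levy_term_O _ _ km Cf); [exact: beta_ge|].
have [S S0 HS] : pairO alpha (fun s t => \sum_(k < m.*2.-1) (k.+1`!%:R)^-1 *
    (derive1n k.+1 f (y s) * A s t (('X - (y s)%:P) ^+ k))).
  apply: pairO_sum => k; have [|C C0 H] := termO k.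
    by have := ltn_ord k; lia.
  exists (`|k.+1`!%:R^-1| * C) => [|s t st]; first exact: mulr_ge0.
  by rewrite normrM -mulrA ler_wpM2l ?H.
exists (L * K + S) => [|s t st]; first by rewrite addr_ge0// mulr_ge0.
apply: (le_trans (ler_normD _ _)); rewrite [leRHS]mulrDl lerD ?HS//.
by rewrite normrM mulrAC ler_pM ?xL.
Qed.

(** Meant for continuity in [u] at a fixed step [e]. The chain relation rewrites the difference as a
    moment plus [A s t]; since [r] may be far away, the triangle has only one short side and its
    area only the exponent [alpha]. *)
Lemma A_monomial_moving_end k : (k <= m.*2 - 2)%N ->
  exists2 C, 0 <= C & forall r s t, `|t - s| <= 1 ->
    `|A r t 'X^k - A r s 'X^k| <= C * `|t - s| `^ alpha.
Proof.
move=> km.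
have [C C0 H] := pairO_W _ _ _ beta_ge alpha_gt0 (A_monomial_O _ km).
have [L L0 xL] := x_holder; have [L' L'0 yL] := y_holder.
pose B := M ^+ k + k%:R * M ^+ k.-1 * (M + M).
have MM : 0 <= M + M by rewrite addr_ge0// M_ge0.
have B0 : 0 <= B by rewrite addr_ge0 ?mulr_ge0 ?exprn_ge0 ?M_ge0.
have mom r s t : `|moment r s t k| <= B * `|area r s t|.
  have d v : `|y v - y r| <= M + M.
    by apply: (le_trans (ler_normB _ _)); rewrite lerD.
  have := @signed_moment_near R (x r, y r) (x s, y s) (x t, y t) k (y r)
    (M + M) M (y_le _) (y_le _) (y_le _) (y_le _) (d _) (d _) (d _).
  move=> H1; rewrite -[moment _ _ _ _](@subrK _ (y r ^+ k * area r s t)).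
  apply: (le_trans (ler_normD _ _)); rewrite /B mulrDl [leRHS]addrC lerD//.
  rewrite normrM ler_wpM2r// normrX.
  by apply: lerXn2r; rewrite ?nnegrE ?M_ge0.
have ar r s t : `|t - s| <= 1 ->
    `|area r s t| <= (M + M) * (L + L') * `|t - s| `^ alpha.
  move=> st; rewrite /signed_area /= normrM.
  have h2 : `|2^-1 : R| <= 1 by rewrite ger0_norm; lra.
  rewrite -[leRHS]mul1r ler_pM//.
  apply: (le_trans (ler_normB _ _)); rewrite !normrM.
  have dx : `|x r - x s| <= M + M.
    by apply: (le_trans (ler_normB _ _)); rewrite lerD.
  have dy : `|y r - y s| <= M + M.
    by apply: (le_trans (ler_normB _ _)); rewrite lerD.
  have -> : (M + M) * (L + L') * `|t - s| `^ alpha =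
    (L' * `|t - s| `^ alpha) * (M + M) + (M + M) * (L * `|t - s| `^ alpha).
    by ring.
  by apply: lerD; apply: ler_pM => //; [exact: yL|exact: xL].
exists (B * ((M + M) * (L + L')) + C) => [|r s t st].
  by rewrite addr_ge0// !mulr_ge0// addr_ge0.
have -> : A r t 'X^k - A r s 'X^k = moment r s t k + A s t 'X^k.
  by have := A_defect r s t _ km; lra.
apply: (le_trans (ler_normD _ _)); rewrite mulrDl lerD ?H//.
apply: (le_trans (mom _ _ _)); rewrite -mulrA ler_wpM2l//.
exact: ar.
Qed.

Lemma holder_continuous (h : R -> R) (C : R) :
  (forall s t, `|t - s| <= 1 -> `|h t - h s| <= C * `|t - s| `^ alpha) ->
  continuous h.
Proof.
move=> hC s; apply/cvgrPdist_lt => e e0.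
have C0 : 0 < `|C| + 1 by rewrite ltr_pwDr.
have d0 : 0 < (e / (`|C| + 1)) `^ alpha^-1 by rewrite powR_gt0// divr_gt0.
apply/nbhs_ballP; exists (Num.min 1 ((e / (`|C| + 1)) `^ alpha^-1)) => /=.
  by rewrite lt_min ltr01.
move=> t; rewrite /ball/= lt_min distrC => /andP[t1 t2].
rewrite distrC; apply: (le_lt_trans (hC s t (ltW t1))).
have ta : `|t - s| `^ alpha < e / (`|C| + 1).
  have -> : e / (`|C| + 1) = ((e / (`|C| + 1)) `^ alpha^-1) `^ alpha.
    by rewrite -powRrM mulVf ?gt_eqF// powRr1// divr_ge0// ltW.
  by rewrite gt0_ltr_powR ?nnegrE ?(ltW d0).
apply: (@le_lt_trans _ _ ((`|C| + 1) * `|t - s| `^ alpha)).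
  rewrite ler_wpM2r ?powR_ge0//; apply: (le_trans (ler_norm _)).
  by rewrite lerDl.
by rewrite mulrC -ltr_pdivlMr.
Qed.

Lemma x_continuous : continuous x.
Proof.
have [C _ H] := x_holder.
exact: (@holder_continuous x C).
Qed.

Lemma y_continuous : continuous y.
Proof.
have [C _ H] := y_holder.
exact: (@holder_continuous y C).
Qed.

Lemma A_monomial_continuous k e : (k <= m.*2 - 2)%N ->
  continuous (fun u => A u (u + e) 'X^k).
Proof.
move=> km; have [C C0 H] := A_monomial_moving_end _ km.
apply: (@holder_continuous _ (C + C)) => s t st.
rewrite mulrDl.
(* Antisymmetry turns the motion of the first time into the motion of a second one. *)
have -> : A t (t + e) 'X^k - A s (s + e) 'X^k =
    (A t (t + e) 'X^k - A t (s + e) 'X^k) -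
    (A (s + e) t 'X^k - A (s + e) s 'X^k).
  by rewrite (A_antisym t (s + e))// (A_antisym s (s + e))//; ring.
apply: (le_trans (ler_normB _ _)); apply: lerD; last exact: H.
have := H t (s + e) (t + e); rewrite (_ : t + e - (s + e) = t - s); last by ring.
exact.
Qed.

Lemma shift_continuous (z : R -> R) e : continuous z ->
  continuous (fun u => z (u + e)).
Proof.
move=> cz.
have ca : continuous (fun u : R => u + e).
  by move=> v; apply: continuousD; [exact: cvg_id|exact: cvg_cst].
by move=> u; exact: (continuous_comp (ca u) (cz _)).
Qed.

Lemma quadrature_term_continuous f e : continuous f ->
  continuous (fun u => (x (u + e) - x u) * dirac_integral (nu R m)
    (fun theta => f ((1 - theta) * y u + theta * y (u + e)))).
Proof.
move=> cf u; apply: cvgM.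
  by apply: cvgB; [exact: shift_continuous x_continuous _|exact: x_continuous].
apply: (@continuous_sum _ _ _ (fun a v => a.1 *
  f ((1 - a.2) * y v + a.2 * y (v + e)))) => a {}u.
apply: cvgM; first exact: cvg_cst.
apply: (@continuous_comp _ _ _ (fun v => (1 - a.2) * y v + a.2 * y (v + e)) f).
  apply: cvgD; (apply: cvgM; first exact: cvg_cst).
    exact: y_continuous.
  exact: shift_continuous y_continuous _.
exact: cf.
Qed.

Lemma levy_term_continuous f k e : (k <= m.*2 - 2)%N -> Cclass m.*2 f ->
  continuous (fun u => derive1n k.+1 f (y u) *
    A u (u + e) (('X - (y u)%:P) ^+ k)).
Proof.
move=> km Cf.
have Ck : Cclass 0 (derive1n k.+1 f) by apply: Cclass_derive1n Cf; lia.
(* The polynomial itself varies with [u]; recentring at 0 leaves fixed monomials with continuous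
   coefficients. *)
have cA : continuous (fun u => \sum_(i < k.+1)
    ((0 - y u) ^+ i *+ 'C(k, i)) * A u (u + e) 'X^(k - i)).
  apply: continuous_sum => i.
  have c0 : continuous (fun v => 0 - y v).
    by move=> v; apply: cvgB; [exact: cvg_cst|exact: y_continuous].
  have c1 : continuous (fun v => (0 - y v) ^+ i).
    by move=> v; exact: (continuous_comp (c0 v) (@exprn_continuous R i _)).
  have c2 : continuous (fun v => (0 - y v) ^+ i *+ 'C(k, i)).
    rewrite (_ : (fun v => _) = (fun v => (0 - y v) ^+ i * 'C(k, i)%:R)).
      by move=> v; apply: cvgM; [exact: c1|exact: cvg_cst].
    by apply/funext => v; rewrite mulr_natr.
  have c3 : continuous (fun v => A v (v + e) 'X^(k - i)).
    by apply: A_monomial_continuous; lia.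
  by move=> u; apply: cvgM; [exact: c2|exact: c3].
move=> u; apply: cvgM.
  apply: (@continuous_comp _ _ _ y); first exact: y_continuous.
  exact: (Cclass_continuous _ _ Ck).
have AE v : A v (v + e) (('X - (y v)%:P) ^+ k) = \sum_(i < k.+1)
    ((0 - y v) ^+ i *+ 'C(k, i)) * A v (v + e) 'X^(k - i).
  rewrite (A_binomial _ _ _ 0 _ km).
  by apply: eq_bigr => i _; rewrite subr0.
by under eq_fun do rewrite AE; rewrite AE; exact: cA.
Qed.

Lemma germ_continuous f e : Cclass m.*2 f ->
  continuous (fun u => germ f u (u + e)).
Proof.
move=> Cf.
have cs : continuous (fun u => \sum_(k < m.*2.-1) (k.+1`!%:R)^-1 *
    (derive1n k.+1 f (y u) * A u (u + e) (('X - (y u)%:P) ^+ k))).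
  apply: continuous_sum => k u; apply: cvgM; first exact: cvg_cst.
  by apply: levy_term_continuous => //; have := ltn_ord k; lia.
move=> u; apply: cvgD; last exact: cs.
exact: quadrature_term_continuous (Cclass_continuous _ _ Cf) _.
Qed.

Lemma germ_frozen f s t : x t = x s -> A s t = A s s -> germ f s t = 0.
Proof.
move=> xE AE; rewrite /germ xE subrr mul0r add0r AE big1// => k _.
have km : (k <= m.*2 - 2)%N by have := ltn_ord k; lia.
rewrite (A_binomial _ _ _ 0 _ km) big1 ?mulr0// => i _.
by rewrite subr0 A_same ?mulr0//; lia.
Qed.

Lemma averaged_levy_germ_cvg f : Cclass m.*2 f -> 1 < beta + alpha ->
  (forall s t, 1 <= s -> s < t -> x t = x s /\ A s t = A s s) ->
  cvg (e^-1 * (\int[@lebesgue_measure R]_(u in `[0, 1]) germ f u (u + e))%R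
       @[e --> 0^'+]).
Proof.
move=> Cf ba frozen.
have [C C0 HC] := germ_O _ Cf.
(* The germ has size exponent [alpha], so the shift of the averaging window caps the exponent at
   [1 + alpha]. *)
have minle : Num.min (beta + alpha) (1 + alpha) <= beta + alpha.
  by rewrite ge_min lexx.
have [C' C'0 HC'] := tripleOW _ _ _ minle (germ_defect_O _ Cf).
apply: (@averaged_germ_cvg R (germ f) (C + C')
  (Num.min (beta + alpha) (1 + alpha)) alpha) => //.
- by rewrite lt_min ba/= ltrDl.
- by rewrite ge_min lexx orbT.
- exact: addr_ge0.
- by move=> e _; exact: germ_continuous.
- move=> s t st ts1; have ts : 0 <= t - s by lra.
  have := HC s t; rewrite (ger0_norm ts) => H.
  apply: (le_trans (H _)); first lra.
  by rewrite ler_wpM2r ?powR_ge0// lerDl.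
- move=> s u t su ut ts; apply: (le_trans (HC' _ _ _ su ut ts)).
  by rewrite ler_wpM2r ?powR_ge0// lerDr.
- by move=> s t s1 st; have [xE AE] := frozen s t s1 st; exact: germ_frozen.
Qed.

End LevyArea.

(** * Freezing the path and the area outside the unit interval *)

Section Clamp.
Context {R : realType}.
Implicit Types s t : R.

(** The projection onto [0, 1]. Being 1-Lipschitz, it transports the Hoelder and area bounds to all
    real times with the same constants; at nonnegative times it agrees with the freezing used in
    [nc_approx]. *)
Definition clamp (t : R) : R := Num.max 0 (Num.min t 1).

Lemma clamp_in t : clamp t \in `[0, 1].
Proof. by rewrite in_itv/= /clamp le_max lexx/= ge_max ler01 ge_min lexx orbT. Qed.

Lemma clamp_id t : t \in `[0, 1] -> clamp t = t.
Proof. by rewrite in_itv/= => /andP[t0 t1]; rewrite /clamp min_l// max_r. Qed.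

Lemma clamp_ge1 t : 1 <= t -> clamp t = 1.
Proof. by move=> t1; rewrite /clamp min_r// max_r. Qed.

Lemma clamp_min t : 0 <= t -> clamp t = Num.min t 1.
Proof. by move=> t0; rewrite /clamp max_r// le_min t0 ler01. Qed.

Lemma clamp_lipschitz s t : `|clamp t - clamp s| <= `|t - s|.
Proof.
wlog st : s t / s <= t => [H|].
  have [st|/ltW ts] := leP s t; first exact: H.
  by rewrite distrC [leRHS]distrC; exact: H.
have mono : clamp s <= clamp t.
  rewrite /clamp ge_max !le_max lexx/=; apply/orP; right.
  by rewrite le_min !ge_min st lexx orbT.
rewrite !ger0_norm ?subr_ge0//.
have := clamp_in t; have := clamp_in s; rewrite !in_itv/= => /andP[s0 s1] /andP[t0 t1].
have [sneg|spos] := ltP s 0.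
  have [tneg|tpos] := ltP t 0.
    suff -> : clamp t = 0 by lra.
    by rewrite /clamp max_l// ge_min (ltW tneg).
  have : clamp t <= t by rewrite clamp_min// ge_min lexx.
  by lra.
have tpos : 0 <= t by lra.
have [s1'|s1'] := ltP 1 s.
  by rewrite (clamp_ge1 s (ltW s1')); lra.
have : clamp t <= t by rewrite clamp_min// ge_min lexx.
have -> : clamp s = s by apply: clamp_id; rewrite in_itv/= spos.
by lra.
Qed.

Lemma clamp_powR (b : R) s t : 0 <= b ->
  `|clamp t - clamp s| `^ b <= `|t - s| `^ b.
Proof.
by move=> b0; apply: ge0_ler_powR => //; rewrite ?nnegrE//; exact: clamp_lipschitz.
Qed.

Lemma hoelder_clamp (alpha : R) (z : R -> R) : 0 < alpha ->
  hoelder_path alpha z ->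
  pairO alpha (fun s t => z (clamp t) - z (clamp s)) /\
  exists M, forall t, `|z (clamp t)| <= M.
Proof.
move=> a0 [L L0 zL]; split.
  exists L => [|s t _]; first exact: ltW.
  apply: (le_trans (zL _ _ (clamp_in _) (clamp_in _))).
  by rewrite ler_wpM2l ?(ltW L0)// clamp_powR// ltW.
have z0 : (0 : R) \in `[0, 1] by rewrite in_itv/= lexx ler01.
exists (L + `|z 0|) => t; rewrite -[z (clamp t)](@subrK _ (z 0)).
apply: (le_trans (ler_normD _ _)); rewrite lerD2r.
apply: (le_trans (zL _ _ z0 (clamp_in _))); rewrite -[leRHS]mulr1.
rewrite ler_wpM2l ?(ltW L0)// subr0.
have := clamp_in t; rewrite in_itv/= => /andP[t0 t1].
rewrite ger0_norm//.
have -> : 1 = 1 `^ alpha :> R by rewrite powR1.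
by apply: ge0_ler_powR; rewrite ?nnegrE ?(ltW a0).
Qed.

Lemma levy_areaW (alpha : R) (j n : nat) (x y : R -> R) A : 0 < alpha ->
  (0 < j <= n)%N -> levy_area alpha n x y A -> levy_area alpha j x y A.
Proof.
move=> a0 /andP[j0 jn] [Alin Achain [C C0 HC]]; split.
- by move=> s t s01 t01 c p q sp sq; apply: Alin => //; lia.
- by move=> r s t r01 s01 t01 k kj; apply: Achain => //; lia.
exists C => // s t s01 t01 k kj zeta yz.
apply: (le_trans (HC _ _ s01 t01 k _ _ yz)); first by lia.
rewrite ler_wpM2l ?(ltW C0)//.
(* Lowering the exponent requires a positive base; on the diagonal both powers are 0 because
   [j > 0]. *)
have [->|st0] := eqVneq `|t - s| 0.
  by rewrite !powR0 ?mulf_neq0 ?pnatr_eq0 ?gt_eqF//; lia.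
apply: ger_powR; last by rewrite ler_wpM2r ?(ltW a0)// ler_nat leq_double.
rewrite lt_neqAle eq_sym st0 normr_ge0/=.
move: s01 t01; rewrite !in_itv/= ler_norml => /andP[? ?] /andP[? ?].
by apply/andP; split; lra.
Qed.

End Clamp.

Section ClampedFunctional.
Context {R : realType}.
Local Notation mu := (@lebesgue_measure R).

Lemma Rintegral_sum n (F : 'I_n -> R -> R) : (forall i, continuous (F i)) ->
  (\int[mu]_(u in `[0%R, 1%R]) \sum_(i < n) F i u)%R =
  \sum_(i < n) (\int[mu]_(u in `[0%R, 1%R]) F i u)%R.
Proof.
elim: n F => [|n IH] F cF.
  rewrite big_ord0; transitivity (\int[mu]_(u in `[0%R, 1%R]) 0)%R.
    by apply: eq_Rintegral => u _; rewrite big_ord0.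
  by rewrite Rintegral_cst// mul0r.
rewrite big_ord_recl -IH// -RintegralD//.
- by apply: eq_Rintegral => u _; rewrite big_ord_recl.
- exact: continuous_integrable_segment.
- apply: continuous_integrable_segment.
  by apply: continuous_sum => i; exact: cF.
Qed.

Variables (m : nat) (alpha : R) (x y : R -> R) (A : R -> R -> {poly R} -> R).
Hypothesis m_gt0 : (0 < m)%N.
Hypothesis alpha_gt0 : 0 < alpha.
Hypothesis x_holder : hoelder_path alpha x.
Hypothesis y_holder : hoelder_path alpha y.
Hypothesis A_levy : levy_area alpha m x y A.

Let xc t := x (clamp t).
Let yc t := y (clamp t).
Let Ac s t := A (clamp s) (clamp t).

Let xcO : pairO alpha (fun s t => xc t - xc s).
Proof. by have [] := hoelder_clamp _ _ alpha_gt0 x_holder. Qed.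

Let ycO : pairO alpha (fun s t => yc t - yc s).
Proof. by have [] := hoelder_clamp _ _ alpha_gt0 y_holder. Qed.

Let bounded_path : exists M, (forall t, `|xc t| <= M) /\ (forall t, `|yc t| <= M).
Proof.
have [_ [Mx xM]] := hoelder_clamp _ _ alpha_gt0 x_holder.
have [_ [My yM]] := hoelder_clamp _ _ alpha_gt0 y_holder.
by exists (Num.max Mx My); split => t; rewrite le_max ?xM ?yM ?orbT.
Qed.

Let Ac_linear s t c (p q : {poly R}) :
  (size p <= m.*2.-1)%N -> (size q <= m.*2.-1)%N ->
  Ac s t (c *: p + q) = c * Ac s t p + Ac s t q.
Proof. by have [Alin _ _] := A_levy; apply: Alin; exact: clamp_in. Qed.

Let Ac_chain r s t k : (k <= m.*2 - 2)%N ->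
  Ac r s 'X^k + Ac s t 'X^k + Ac t r 'X^k =
  - signed_moment (xc r, yc r) (xc s, yc s) (xc t, yc t) k.
Proof. by have [_ Ach _] := A_levy; apply: Ach; exact: clamp_in. Qed.

Let Ac_le : exists2 C, 0 <= C & forall s t k, (k <= m.*2 - 2)%N ->
  forall zeta, Num.min (yc s) (yc t) <= zeta <= Num.max (yc s) (yc t) ->
  `|Ac s t (('X - zeta%:P) ^+ k)| <= C * `|t - s| `^ (m.*2%:R * alpha).
Proof.
have [_ _ [C C0 HC]] := A_levy; exists C => [|s t k km zeta yz].
  exact: ltW.
apply: (le_trans (HC _ _ (clamp_in _) (clamp_in _) k km zeta yz)).
rewrite ler_wpM2l ?(ltW C0)// clamp_powR//.
by rewrite mulr_ge0// ltW.
Qed.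

Definition clamped_germ := germ m xc yc Ac.

Lemma clamped_germ_continuous f e : Cclass m.*2 f ->
  continuous (fun u => clamped_germ f u (u + e)).
Proof.
move=> Cf; have [M [xM yM]] := bounded_path.
exact: (@germ_continuous R m alpha M xc yc Ac).
Qed.

Lemma nc_approx_germ f e : Cclass m.*2 f -> 0 < e ->
  nc_approx m x y A f e =
  e^-1 * (\int[mu]_(u in `[0%R, 1%R]) clamped_germ f u (u + e))%R.
Proof.
move=> Cf e0; have [M [xM yM]] := bounded_path.
have cq : continuous (fun u => (xc (u + e) - xc u) * dirac_integral (nu R m)
    (fun theta => f ((1 - theta) * yc u + theta * yc (u + e)))).
  by apply: (@quadrature_term_continuous R m alpha xc yc) => //;
    exact: Cclass_continuous Cf.
have ct (k : 'I_m.*2.-1) : continuous (fun u => derive1n k.+1 f (yc u) *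
    Ac u (u + e) (('X - (yc u)%:P) ^+ k)).
  apply: (@levy_term_continuous R m alpha M xc yc Ac) => //.
  by have := ltn_ord k; lia.
have ct' (k : 'I_m.*2.-1) : continuous (fun u => (k.+1`!%:R)^-1 *
    (derive1n k.+1 f (yc u) * Ac u (u + e) (('X - (yc u)%:P) ^+ k))).
  by move=> u; apply: cvgM; [exact: cvg_cst|exact: ct].
rewrite /clamped_germ /germ RintegralD//; last 2 first.
- exact: continuous_integrable_segment.
- by apply: continuous_integrable_segment; exact: continuous_sum.
rewrite Rintegral_sum// mulrDr /nc_approx big_mkord.
have uE u : u \in `[0, 1] -> clamp u = u /\ clamp (u + e) = Num.min (u + e) 1.
  move=> u01; split; first exact: clamp_id.
  apply: clamp_min; move: u01; rewrite in_itv/= => /andP[u0 _].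
  by rewrite addr_ge0// ltW.
congr (_ * _ + _ * _).
  apply: eq_Rintegral => u; rewrite inE /= => /uE[u1 u2].
  by rewrite /xc /yc u1 u2.
apply: eq_bigr => k _; rewrite RintegralZl//; last first.
  by apply: continuous_integrable_segment; exact: ct.
congr (_ * _); apply: eq_Rintegral => u; rewrite inE /= => /uE[u1 u2].
by rewrite /Ac /yc u1 u2.
Qed.

Lemma nc_approx_cvg f : Cclass m.*2 f -> 1 < m.*2.+1%:R * alpha ->
  cvg (nc_approx m x y A f e @[e --> 0^'+]).
Proof.
move=> Cf ma; have [M [xM yM]] := bounded_path.
have ba : 1 < m.*2%:R * alpha + alpha.
  by move: ma; rewrite -natr1 mulrDl mul1r.
have H : cvg (e^-1 * (\int[mu]_(u in `[0, 1]) clamped_germ f u (u + e))%R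
       @[e --> 0^'+]).
  apply: (@averaged_levy_germ_cvg R m alpha M xc yc Ac) => // s t s1 st.
  have t1 : 1 <= t by lra.
  by rewrite /xc /Ac (clamp_ge1 s)// (clamp_ge1 t).
have [l Hl] : exists l : R, e^-1 *
    (\int[mu]_(u in `[0, 1]) clamped_germ f u (u + e))%R @[e --> 0^'+] --> l.
  by exists (lim (e^-1 *
    (\int[mu]_(u in `[0, 1]) clamped_germ f u (u + e))%R @[e --> 0^'+])).
apply: (cvgP l); apply: cvg_trans Hl; apply: near_eq_cvg; near=> e.
have e0 : 0 < e by near: e; exact: nbhs_right_gt.
by rewrite nc_approx_germ.
Unshelve. all: by end_near. Qed.

Lemma clamped_levy_term_O f k : (k <= m.*2 - 2)%N -> Cclass m.*2 f ->
  pairO (m.*2%:R * alpha) (fun s t =>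
    derive1n k.+1 f (yc s) * Ac s t (('X - (yc s)%:P) ^+ k)).
Proof.
move=> km Cf; have [M [xM yM]] := bounded_path.
exact: (@levy_term_O R m alpha M yc Ac).
Qed.

(** Both rules integrate the same Taylor polynomial of order 2j exactly, so only the two remainders
    are left. *)
Lemma quadrature_diff_O (j : nat) f : (0 < j)%N -> Cclass j.*2 f ->
  tripleO (j.*2%:R * alpha) (fun s _ t =>
    dirac_integral (nu R j.+1)
      (fun theta => f ((1 - theta) * yc s + theta * yc t)) -
    dirac_integral (nu R j)
      (fun theta => f ((1 - theta) * yc s + theta * yc t))).
Proof.
move=> j0 Cf; have [M [xM yM]] := bounded_path.
have [C C0 HC] := quadrature_taylor j _ f M j0 (leqnn _) Cf.
have jj : (j.*2 <= j.+1.*2)%N by rewrite leq_double.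
have [C' C'0 HC'] := quadrature_taylor j.+1 _ f M (ltn0Sn _) jj Cf.
have [_ _ yO _] := pairO_triple _ _ (ltW alpha_gt0) ycO.
apply: tripleO_le (tripleOX _ _ j.*2 yO) => [|s u t _ _ _].
  exact: addr_ge0 C'0 C0.
have yE : yc s + (yc t - yc s) = yc t by rewrite addrC subrK.
have := HC (yc s) 0 (yc t - yc s).
have := HC' (yc s) 0 (yc t - yc s).
rewrite yE addr0 normr0 add0r => /(_ (yM _) (yM _) (yM _)) H1.
move=> /(_ (yM _) (yM _) (yM _)) H2.
set S := \sum_(i < j.*2) _ in H1 H2.
set E1 := dirac_integral _ _ in H1 *; set E2 := dirac_integral _ _ in H2 *.
have -> : E1 - E2 = (E1 - S) - (E2 - S) by ring.
apply: (le_trans (ler_normB _ _)); rewrite [leRHS]mulrDl normrX.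
exact: lerD.
Qed.

End ClampedFunctional.

(** * Comparison of consecutive orders *)

Lemma clamped_germ_diff_O {R : realType} (j n : nat) (alpha : R) (x y : R -> R)
    A f : (0 < j < n)%N -> 0 < alpha -> hoelder_path alpha x ->
  hoelder_path alpha y -> levy_area alpha n x y A -> Cclass n.*2 f ->
  tripleO (j.*2.+1%:R * alpha) (fun s _ t =>
    clamped_germ j.+1 x y A f s t - clamped_germ j x y A f s t).
Proof.
move=> /andP[j0 jn] a0 hx hy hA Cf.
have Cj : Cclass j.*2 f by apply: CclassW Cf; rewrite leq_double ltnW.
have [xO _] := hoelder_clamp _ _ a0 hx.
have [_ _ xO' _] := pairO_triple _ _ (ltW a0) xO.
have qO := quadrature_diff_O alpha x y a0 hx hy j f j0 Cj.
have termO k : (k <= n.*2 - 2)%N -> tripleO (j.*2.+1%:R * alpha) (fun s _ t =>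
    (k.+1`!%:R)^-1 * (derive1n k.+1 f (y (clamp s)) *
    A (clamp s) (clamp t) (('X - (y (clamp s))%:P) ^+ k))).
  move=> kn.
  have n0 : (0 < n)%N by exact: leq_ltn_trans jn.
  (* The bound of order [n] is used for every [k]: each Levy term, shared by the two orders or not,
     is then negligible by itself. *)
  have TO := clamped_levy_term_O n alpha x y A n0 a0 hx hy hA f k kn Cf.
  have na : 0 <= n.*2%:R * alpha by rewrite mulr_ge0// ltW.
  have [_ _ TO' _] := pairO_triple _ _ na TO.
  rewrite -[X in tripleO X _]add0r; apply: tripleOM.
    exact: (@tripleO_bounded _ _ `|k.+1`!%:R^-1|).
  apply: tripleOW TO'; rewrite ler_wpM2r ?(ltW a0)// ler_nat.
  by move: jn; rewrite -ltn_double -ltnS; lia.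
have sumO i : (i <= n)%N -> tripleO (j.*2.+1%:R * alpha) (fun s _ t =>
    \sum_(k < i.*2.-1) (k.+1`!%:R)^-1 * (derive1n k.+1 f (y (clamp s)) *
    A (clamp s) (clamp t) (('X - (y (clamp s))%:P) ^+ k))).
  move=> i_n; apply: tripleO_sum => k _; apply: termO.
  by have := ltn_ord k; lia.
have xqO := tripleOM _ _ _ _ qO xO'.
have jE : j.*2%:R * alpha + alpha = j.*2.+1%:R * alpha.
  by rewrite -natr1 mulrDl mul1r.
rewrite jE in xqO.
have := tripleOD _ _ _ xqO (tripleOB _ _ _ (sumO _ jn) (sumO _ (ltnW jn))).
by apply: tripleO_ext => s u t; rewrite /clamped_germ /germ; ring.
Qed.

Lemma nc_approx_diff_cvg0 {R : realType} (j n : nat) (alpha : R) (x y : R -> R)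
    A f : (0 < j < n)%N -> 0 < alpha -> hoelder_path alpha x ->
  hoelder_path alpha y -> levy_area alpha n x y A -> Cclass n.*2 f ->
  1 < j.*2.+1%:R * alpha ->
  nc_approx j.+1 x y A f e - nc_approx j x y A f e @[e --> 0^'+] --> (0 : R).
Proof.
move=> jn a0 hx hy hA Cf ja; have /andP[j0 jn'] := jn.
have [C C0 HC] := clamped_germ_diff_O _ _ _ _ _ _ _ jn a0 hx hy hA Cf.
set b := j.*2.+1%:R * alpha in ja HC.
have Cj : Cclass j.*2 f by apply: CclassW Cf; rewrite leq_double ltnW.
have Cj1 : Cclass j.+1.*2 f by apply: CclassW Cf; rewrite leq_double.
have hAj : levy_area alpha j x y A.
  by apply: levy_areaW hA => //; rewrite j0 ltnW.
have hAj1 : levy_area alpha j.+1 x y A by apply: levy_areaW hA.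
have bound : \forall e \near (0:R)^'+,
    - (C * e `^ (b - 1)) <= nc_approx j.+1 x y A f e - nc_approx j x y A f e
      <= C * e `^ (b - 1).
  near=> e.
  have e0 : 0 < e by near: e; exact: nbhs_right_gt.
  have e1 : e <= 1 by near: e; apply: nbhs_right_le; exact: ltr01.
  rewrite -ler_norml (nc_approx_germ _ alpha)// (nc_approx_germ _ alpha)//.
  have c1 := clamped_germ_continuous j.+1 alpha x y A (ltn0Sn _) a0 hx hy hAj1
    f e Cj1.
  have c2 := clamped_germ_continuous j alpha x y A j0 a0 hx hy hAj f e Cj.
  rewrite -mulrBr -RintegralB//; last 2 first.
  - exact: continuous_integrable_segment.
  - exact: continuous_integrable_segment.
  rewrite normrM gtr0_norm ?invr_gt0// mulrC ler_pdivrMr//.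
  have -> : C * e `^ (b - 1) * e = C * e `^ b.
    by rewrite -mulrA [_ * e]mulrC mulr_powRB1 ?(ltW e0)//; lra.
  apply: Rintegral01_bound => [u|u _].
    by apply: cvgB; [exact: c1|exact: c2].
  (* The midpoint is a placeholder for the middle time of [tripleO], on which this error does not
     depend. *)
  have := HC u (u + e / 2) (u + e); rewrite (_ : u + e - u = e); last by ring.
  by apply; lra.
have lim0 : C * e `^ (b - 1) @[e --> 0^'+] --> (0 : R).
  have b1 : 0 < b - 1 by rewrite subr_gt0.
  rewrite -[X in _ --> X](mulr0 C).
  by apply: cvgM; [exact: cvg_cst|exact: powR_cvg0].
apply: (squeeze_cvgr bound) => //.
by rewrite -[X in _ --> X]oppr0; exact: cvgN.
Unshelve. all: by end_near. Qed.

Theorem theorem2p5 (R : realType) (m : nat) (alpha : R) (x y : R -> R) :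
  (1 <= m)%N -> 0 < alpha < 1 -> (m.*2.+1%:R)^-1 < alpha ->
  hoelder_path alpha x -> hoelder_path alpha y ->
  (forall (A : R -> R -> {poly R} -> R) (f : R -> R),
     levy_area alpha m x y A -> Cclass m.*2 f ->
     cvg (nc_approx m x y A f eps @[eps --> 0^'+])) /\
  (forall (n : nat) (A : R -> R -> {poly R} -> R) (f : R -> R),
     (m < n)%N -> levy_area alpha n x y A -> Cclass n.*2 f ->
     (forall j, (m <= j <= n)%N ->
        cvg (nc_approx j x y A f eps @[eps --> 0^'+])) /\
     (forall j, (m <= j < n)%N ->
        nc_integral j.+1 x y A f = nc_integral j x y A f)).
Proof.
move=> m0 /andP[a0 _] ma hx hy.
have large j : (m <= j)%N -> 1 < j.*2.+1%:R * alpha.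
  move=> mj; apply: (@lt_le_trans _ _ (m.*2.+1%:R * alpha)).
    by rewrite mulrC -ltr_pdivrMr ?ltr0n// mul1r.
  by rewrite ler_wpM2r ?(ltW a0)// ler_nat ltnS leq_double.
have conv j A f : (m <= j)%N -> levy_area alpha j x y A -> Cclass j.*2 f ->
    cvg (nc_approx j x y A f eps @[eps --> 0^'+]).
  move=> mj hA Cf; apply: (@nc_approx_cvg R j alpha) => //; last exact: large.
  exact: leq_trans mj.
split=> [A f hA Cf|n A f mn hA Cf]; first exact: conv.
have convj j : (m <= j <= n)%N -> cvg (nc_approx j x y A f eps @[eps --> 0^'+]).
  move=> /andP[mj jn]; apply: conv => //.
    by apply: levy_areaW hA => //; rewrite (leq_trans m0 mj).
  by apply: CclassW Cf; rewrite leq_double.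
split=> // j /andP[mj jn].
have dif : nc_approx j.+1 x y A f e - nc_approx j x y A f e @[e --> 0^'+] -->
    (0 : R).
  apply: (@nc_approx_diff_cvg0 R j n alpha) => //; last exact: large.
  by rewrite jn (leq_trans m0 mj).
have lim_j : nc_approx j x y A f e @[e --> 0^'+] --> nc_integral j x y A f.
  by apply: convj; rewrite mj ltnW.
apply: cvg_lim => //.
rewrite -[X in _ --> X]add0r.
have -> : nc_approx j.+1 x y A f = fun e =>
    (nc_approx j.+1 x y A f e - nc_approx j x y A f e) + nc_approx j x y A f e.
  by apply/funext => e; rewrite subrK.
exact: cvgD dif lim_j.
Qed.
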